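(* Let $E$ be a Hilbert $C^*$-module over a $C^*$-algebra $\mathcal{A}$ and let $S$ and $T$ be selfadjoint regular operators in $E$ with domains $\mathrm{dom}(S)$ and $\mathrm{dom}(T)$. Assume that there is a dense submodule $\mathcal{E}\subset E$ such that: (1) $\mathcal{E}\subset\mathrm{dom}(T)$ is a core for $T$. (2) $(S-i\mu)^{-1}\xi\in\mathrm{dom}(S)\cap\mathrm{dom}(T)$ and $T(S-i\mu)^{-1}\xi\in\mathrm{dom}(S)$ for all $\mu\in\mathbb{R}\setminus\{0\}$ and all $\xi\in\mathcal{E}$. (3) For all $\mu\in\mathbb{R}\setminus\{0\}$ the module homomorphism $[S,T](S-i\mu)^{-1}:\mathcal{E}\to E$ extends to a bounded $\mathcal{A}$-linear operator $X_\mu:E\to E$. Then the operator $$D=\begin{pmatrix}0&S-iT\\ S+iT&0\end{pmatrix},\qquad \mathrm{dom}(D)=\big(\mathrm{dom}(S)\cap\mathrm{dom}(T)\big)^2\subset E\oplus E,$$ is selfadjoint and regular.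
   Context: $C^*$-algebras are not assumed unital. A Hilbert $C^*$-module $E$ over $\mathcal{A}$ is a right $\mathcal{A}$-module with an $\mathcal{A}$-valued inner product $\langle\cdot,\cdot\rangle$ (conjugate linear in the first, linear in the second variable), complete in the norm $\|x\|=\|\langle x,x\rangle\|^{1/2}$. A semiregular operator in $E$ is an operator $T:\mathrm{dom}(T)\to E$ defined on a dense $\mathcal{A}$-submodule $\mathrm{dom}(T)\subset E$ whose adjoint $T^*$ is densely defined; here $y\in\mathrm{dom}(T^* )$ iff there is $z=T^*y\in E$ with $\langle Tx,y\rangle=\langle x,z\rangle$ for all $x\in\mathrm{dom}(T)$. A closed semiregular operator $T$ is called regular if $I+T^*T$ has dense range (it is then invertible). $T$ is selfadjoint if $T=T^*$. For $S$ selfadjoint and regular, $S-i\mu$ is invertible for every $\mu\in\mathbb{R}\setminus\{0\}$. A submodule $\mathcal{E}\subset\mathrm{dom}(T)$ is a core for $T$ if it is dense in $\mathrm{dom}(T)$ in the graph norm. The commutator $[S,T]=ST-TS$ has its natural domain $\{\xi\in\mathrm{dom}(S)\cap\mathrm{dom}(T): T\xi\in\mathrm{dom}(S),\ S\xi\in\mathrm{dom}(T)\}$; under (1) and (2) this contains $(S-i\mu)^{-1}\mathcal{E}$. *)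

(* Defs.v *)
From HB Require Import structures.
From mathcomp Require Import all_boot all_order all_algebra.
From mathcomp Require Import complex.
From mathcomp Require Import all_classical all_reals all_analysis.

Set Implicit Arguments.
Unset Strict Implicit.
Unset Printing Implicit Defensive.

Import Order.TTheory GRing.Theory Num.Theory.
Import numFieldNormedType.Exports.

Local Open Scope classical_set_scope.
Local Open Scope ring_scope.
Local Open Scope complex_scope.

(* MathComp rings are unital, so the product of a (possibly non-unital)
   C*-algebra is a separate operation on a complex Banach space. *)
HB.mixin Record isCStarAlgebra (R : realType) A
    of CompleteNormedModule R[i] A := {
  cmul : A -> A -> A;
  cstar : A -> A;
  cmulA : forall a b c, cmul a (cmul b c) = cmul (cmul a b) c;
  cmulDl : forall a b c, cmul (a + b) c = cmul a c + cmul b c;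
  cmulDr : forall a b c, cmul a (b + c) = cmul a b + cmul a c;
  cmulZl : forall (l : R[i]) a b, cmul (l *: a) b = l *: cmul a b;
  cmulZr : forall (l : R[i]) a b, cmul a (l *: b) = l *: cmul a b;
  cstarD : forall a b, cstar (a + b) = cstar a + cstar b;
  cstarZ : forall (l : R[i]) a, cstar (l *: a) = conjc l *: cstar a;
  cstarK : forall a, cstar (cstar a) = a;
  cstarM : forall a b, cstar (cmul a b) = cmul (cstar b) (cstar a);
  cmul_norm : forall a b, `|cmul a b| <= `|a| * `|b|;
  cstar_norm : forall a, `|cmul (cstar a) a| = `|a| ^+ 2
}.

#[short(type="cstarAlgType")]
HB.structure Definition CStarAlgebra (R : realType) :=
  {A of isCStarAlgebra R A & CompleteNormedModule R[i] A}.

Definition cpositive (R : realType) (A : cstarAlgType R) (a : A) : Prop :=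
  exists b : A, a = cmul (cstar b) b.

(* Right A-modules with an A-valued Hermitian form, not assumed positive,
   definite or complete.  Operators, adjoints and regularity only depend on
   this structure, which the direct sum E (+) E carries by inspection. *)
HB.mixin Record isFormModule (R : realType) (A : cstarAlgType R) E
    of GRing.Lmodule R[i] E := {
  ract : E -> A -> E;
  ip : E -> E -> A;
  ractDl : forall x y a, ract (x + y) a = ract x a + ract y a;
  ractDr : forall x a b, ract x (a + b) = ract x a + ract x b;
  ractA : forall x a b, ract x (cmul a b) = ract (ract x a) b;
  ractZl : forall (l : R[i]) x a, ract (l *: x) a = l *: ract x a;
  ractZr : forall (l : R[i]) x a, ract x (l *: a) = l *: ract x a;
  ipDr : forall x y z, ip x (y + z) = ip x y + ip x z;
  ipZr : forall (l : R[i]) x y, ip x (l *: y) = l *: ip x y;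
  ipMr : forall x y a, ip x (ract y a) = cmul (ip x y) a;
  ipC : forall x y, cstar (ip x y) = ip y x
}.

#[short(type="formModType")]
HB.structure Definition FormModule (R : realType) (A : cstarAlgType R) :=
  {E of isFormModule R A E & GRing.Lmodule R[i] E}.

(* The norm of A takes its values in R[i], hence the real part. *)
Definition hnorm (R : realType) (A : cstarAlgType R) (E : formModType A)
    (x : E) : R :=
  Num.sqrt (complex.Re `|ip x x : A|).

HB.mixin Record isHilbertModule (R : realType) (A : cstarAlgType R) E
    of FormModule R A E := {
  ip_pos : forall x : E, cpositive (ip x x : A);
  ip_def : forall x : E, (ip x x : A) = 0 -> x = 0;
  hnorm_complete : forall u : nat -> E,
    (forall e : R, 0 < e -> exists N : nat, forall m n : nat,
       (N <= m)%N -> (N <= n)%N -> @hnorm R A E (u m - u n) < e) ->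
    exists l : E, forall e : R, 0 < e -> exists N : nat, forall n : nat,
       (N <= n)%N -> @hnorm R A E (u n - l) < e
}.

#[short(type="hilbertModType")]
HB.structure Definition HilbertModule (R : realType) (A : cstarAlgType R) :=
  {E of isHilbertModule R A E & FormModule R A E}.

Section DirectSum.
Variables (R : realType) (A : cstarAlgType R) (E F : formModType A).

Definition dract (x : E * F) (a : A) : E * F := (ract x.1 a, ract x.2 a).
Definition dip (x y : E * F) : A := ip x.1 y.1 + ip x.2 y.2.

Fact dractDl x y a : dract (x + y) a = dract x a + dract y a.
Proof. by rewrite /dract /= !ractDl. Qed.
Fact dractDr x a b : dract x (a + b) = dract x a + dract x b.
Proof. by rewrite /dract /= !ractDr. Qed.
Fact dractA x a b : dract x (cmul a b) = dract (dract x a) b.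
Proof. by rewrite /dract /= !ractA. Qed.
Fact dractZl (l : R[i]) x a : dract (l *: x) a = l *: dract x a.
Proof. by rewrite /dract /= !ractZl. Qed.
Fact dractZr (l : R[i]) x a : dract x (l *: a) = l *: dract x a.
Proof. by rewrite /dract /= !ractZr. Qed.
Fact dipDr x y z : dip x (y + z) = dip x y + dip x z.
Proof. by rewrite /dip /= !ipDr addrACA. Qed.
Fact dipZr (l : R[i]) x y : dip x (l *: y) = l *: dip x y.
Proof. by rewrite /dip /= !ipZr scalerDr. Qed.
Fact dipMr x y a : dip x (dract y a) = cmul (dip x y) a.
Proof. by rewrite /dip /= !ipMr cmulDl. Qed.
Fact dipC x y : cstar (dip x y) = dip y x.
Proof. by rewrite /dip cstarD !ipC. Qed.

HB.instance Definition _ := isFormModule.Build R A (E * F)%type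
  dractDl dractDr dractA dractZl dractZr dipDr dipZr dipMr dipC.
End DirectSum.

Section Topology.
Variables (R : realType) (A : cstarAlgType R) (E : formModType A).

Definition hclosure (X : set E) : set E :=
  [set x | forall e : R, 0 < e -> exists2 y, X y & hnorm (x - y) < e].

Definition hdense (X : set E) : Prop := forall x : E, hclosure X x.

Definition is_submodule (X : set E) : Prop :=
  [/\ X 0, forall x y, X x -> X y -> X (x + y),
      forall (l : R[i]) x, X x -> X (l *: x) &
      forall x (a : A), X x -> X (ract x a)].

End Topology.

(* A partially defined operator; its values outside the domain are
   irrelevant. *)
Record oper (U V : Type) := Oper { odom : set U; oval :> U -> V }.

Definition oper_eq (U V : Type) (T1 T2 : oper U V) : Prop :=
  odom T1 = odom T2 /\ forall x, odom T1 x -> T1 x = T2 x.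

Section OperAlgebra.
Variables (R : realType) (E F : lmodType R[i]).

Definition oid : oper E E := Oper setT id.

Definition oadd (T1 T2 : oper E F) : oper E F :=
  Oper (odom T1 `&` odom T2) (fun x => T1 x + T2 x).

Definition oscale (l : R[i]) (T : oper E F) : oper E F :=
  Oper (odom T) (fun x => l *: T x).

Definition osub (T1 T2 : oper E F) : oper E F := oadd T1 (oscale (-1) T2).

Definition ocomp (G : Type) (T1 : oper F G) (T2 : oper E F) : oper E G :=
  Oper [set x | odom T2 x /\ odom T1 (T2 x)] (fun x => T1 (T2 x)).

(* Meaningful when T is injective on its domain. *)
Definition oinv (T : oper E F) : oper F E :=
  Oper [set T x | x in odom T] (fun y => xget 0 [set x | odom T x /\ T x = y]).

(* The operator matrix [[0, B], [C, 0]] on E (+) F. *)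
Definition offdiag (B : oper F E) (C : oper E F) : oper (E * F) (E * F) :=
  Oper [set x | odom C x.1 /\ odom B x.2] (fun x => (B x.2, C x.1)).

End OperAlgebra.

Arguments oid {R E}.

(* (S - i mu)^-1 *)
Definition resolvent (R : realType) (E : lmodType R[i]) (S : oper E E)
    (mu : R) : oper E E :=
  oinv (osub S (oscale ('i * mu%:C) oid)).

Definition commutator (R : realType) (E : lmodType R[i]) (S T : oper E E) :
    oper E E :=
  osub (ocomp S T) (ocomp T S).

Section Operators.
Variables (R : realType) (A : cstarAlgType R) (E : formModType A).
Implicit Types (T : oper E E) (X : set E).

Definition is_linear_on X (f : E -> E) : Prop :=
  [/\ forall x y, X x -> X y -> f (x + y) = f x + f y,
      forall (l : R[i]) x, X x -> f (l *: x) = l *: f x &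
      forall x (a : A), X x -> f (ract x a) = ract (f x) a].

(* Meaningful when the domain of T is dense, since z is then unique. *)
Definition oadjoint T : oper E E :=
  let adj y := [set z | forall x, odom T x -> ip (T x) y = ip x z :> A] in
  Oper [set y | exists z, adj y z] (fun y => xget 0 (adj y)).

Definition semiregular T : Prop :=
  [/\ is_submodule (odom T), hdense (odom T), is_linear_on (odom T) T &
      hdense (odom (oadjoint T))].

Definition graph T : set (E * E)%type := [set (x, T x) | x in odom T].

Definition oclosed T : Prop := hclosure (graph T) `<=` graph T.

Definition orange T : set E := [set T x | x in odom T].

Definition regular T : Prop :=
  [/\ semiregular T, oclosed T &
      hdense (orange (oadd oid (ocomp (oadjoint T) T)))].

Definition selfadjoint T : Prop := semiregular T /\ oper_eq T (oadjoint T).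

(* The graph norm of x is the norm of (x, T x) in E (+) E. *)
Definition is_core T X : Prop :=
  X `<=` odom T /\
  forall x, odom T x -> forall e : R, 0 < e ->
    exists2 y, X y & hnorm ((x - y, T (x - y)) : (E * E)%type) < e.

Definition bounded_oper (f : E -> E) : Prop :=
  exists M : R, forall x, hnorm (f x) <= M * hnorm x.

End Operators.

(* Main.v *)
(* With J the swap of E (+) E, S acting diagonally and T replaced by
   T' = [[0, - iT], [iT, 0]], D = S J + T' where J commutes with S and
   anticommutes with T'.  Let Q_k = (T' - ik)^-1.  The commutator hypothesis says
   that [S, T'] = Y (S - i) with Y bounded, and a Neumann series then shows that
   the Q_k preserve dom S with [S, Q_k] = O(1/k^2) (S - i).  Hence
   P_k = k^2 Q_k Q_-k and the bounded operator T_k = T' P_k satisfy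
   [S, P_k] = O(1/k) (S - i) and [S, T_k] = O(1) (S - i).  The operator
   D_k = S J + T_k is a bounded perturbation of S J, so D_k + i and D_k - i are
   onto, and expanding <D_k x, D_k x> bounds S x and T_k x by (D_k +- i) x,
   uniformly in k.  If (D_k +- i) x = y with y in dom T', then (D +- i) P_k x
   tends to y.  So D + i and D - i have dense, hence full, range, which makes the
   symmetric operator D selfadjoint and regular.

   The norm estimates need the order structure of a C*-algebra, that is, b* b
   being positive: this is proved in the algebra of adjointable operators on A,
   where a is called positive if it is selfadjoint and |t - a| <= t for some
   t >= 0, with square roots produced by an iteration. *)

Require Import Defs.
From HB Require Import structures.
From mathcomp Require Import all_boot all_order all_algebra.
From mathcomp Require Import complex ring lra.
From mathcomp Require Import all_classical all_reals all_analysis.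

(** A closed submodule of a Hilbert module need not be complemented, so injectivity of the adjoints
    would not make the ranges of D + i and D - i dense: approximate solutions must be constructed.
    The swap J turns an anticommutator into a commutator: as J T' = - T' J, formally (S J) T' + T'
    (S J) = J [S, T'], which is bounded relative to S. In <D_k x, D_k x> this cross term is only
    linear in S x, against the square of S x, so it is absorbed whatever the norm of Y. The
    expansion uses T_k because T_k is bounded and preserves dom S, so that every product in it is
    defined. The price is that the bound on T_k is k: surjectivity is obtained for D_k - i mu with
    |mu| > k and brought back to mu = 1 and mu = -1 by the lower bound |mu| |x| <= |(D_k - i mu) x|,
    valid for every symmetric operator. *)

Module HilbertModules.

Set Implicit Arguments.
Unset Strict Implicit.
Unset Printing Implicit Defensive.
Import Order.TTheory GRing.Theory Num.Theory.
Import numFieldNormedType.Exports.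
Local Open Scope classical_set_scope.
Local Open Scope ring_scope.
Local Open Scope complex_scope.

(** * C*-algebras *)

Section RealNorm.
Variables (R : realType) (V : normedModType R[i]).

Definition rnorm (x : V) : R := complex.Re `|x|.

Lemma rnormE x : `|x| = (rnorm x)%:C.
Proof. by rewrite /rnorm RRe_real // ger0_real. Qed.

Lemma rnorm_ge0 x : 0 <= rnorm x.
Proof. by rewrite -ler0c -rnormE. Qed.

Lemma rnormD x y : rnorm (x + y) <= rnorm x + rnorm y.
Proof. by rewrite -lecR rmorphD /= -!rnormE; exact: ler_normD. Qed.

Lemma rnormZ (l : R[i]) x : rnorm (l *: x) = complex.Re `|l| * rnorm x.
Proof.
apply: complexI; rewrite rmorphM -!rnormE normrZ.
by rewrite /= RRe_real // ger0_real.
Qed.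

Lemma rnormN x : rnorm (- x) = rnorm x.
Proof. by rewrite /rnorm normrN. Qed.

Lemma rnormB x y : rnorm (x - y) <= rnorm x + rnorm y.
Proof. by rewrite -(rnormN y) rnormD. Qed.

Lemma rnorm0 : rnorm 0 = 0.
Proof. by rewrite /rnorm normr0. Qed.

Lemma rnorm0_eq0 x : rnorm x = 0 -> x = 0.
Proof. by move=> h; apply/eqP; rewrite -normr_eq0 rnormE h. Qed.

Lemma rnormMr (t : R) x : rnorm (t%:C *: x) = `|t| * rnorm x.
Proof. by rewrite rnormZ normc_def /= expr0n addr0 sqrtr_sqr. Qed.

End RealNorm.

Lemma rnorm_complete (R : realType) (V : completeNormedModType R[i])
    (u : nat -> V) :
  (forall e : R, 0 < e -> exists N, forall m n, (N <= m)%N -> (N <= n)%N ->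
     rnorm (u m - u n) < e) ->
  exists l, forall e : R, 0 < e -> exists N, forall n, (N <= n)%N ->
     rnorm (u n - l) < e.
Proof.
move=> uC.
have ucvg : cvg (u @ \oo).
  apply/cauchy_cvgP/cauchy_exP => e e0.
  have eE : e = (complex.Re e)%:C by rewrite RRe_real // gtr0_real.
  have /uC[N hN] : 0 < complex.Re e by rewrite -ltcR -eE.
  exists (u N); exists N => // n /= Nn.
  by rewrite -ball_normE /= rnormE eE ltcR hN.
exists (lim (u @ \oo)) => e e0.
have h := (cvgrPdist_lt _ _).1 ucvg e%:C.
have [|N _ hN] := h _; first by rewrite ltcR.
exists N => n /hN /=.
by rewrite distrC rnormE ltcR.
Qed.

Section CStarBasics.
Variables (R : realType) (A : cstarAlgType R).
Implicit Types a b c : A.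

Lemma cmulNl a b : cmul (- a) b = - cmul a b.
Proof. by rewrite -scaleN1r cmulZl scaleN1r. Qed.
Lemma cmulNr a b : cmul a (- b) = - cmul a b.
Proof. by rewrite -scaleN1r cmulZr scaleN1r. Qed.
Lemma cmulBl a b c : cmul (a - b) c = cmul a c - cmul b c.
Proof. by rewrite cmulDl cmulNl. Qed.
Lemma cmulBr a b c : cmul a (b - c) = cmul a b - cmul a c.
Proof. by rewrite cmulDr cmulNr. Qed.
Lemma cstarN a : cstar (- a) = - cstar a.
Proof. by rewrite -scaleN1r cstarZ rmorphN1 scaleN1r. Qed.
Lemma cstarB a b : cstar (a - b) = cstar a - cstar b.
Proof. by rewrite cstarD cstarN. Qed.
Lemma cstar0 : cstar (0 : A) = 0.
Proof. by have := cstarZ 0 (0 : A); rewrite conjc0 !scale0r. Qed.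

Lemma rnorm_cmul a b : rnorm (cmul a b) <= rnorm a * rnorm b.
Proof. by rewrite -lecR rmorphM /= -!rnormE cmul_norm. Qed.

Lemma rnorm_csqr a : rnorm (cmul (cstar a) a) = rnorm a ^+ 2.
Proof. by apply: complexI; rewrite rmorphXn /= -!rnormE cstar_norm. Qed.

Lemma rnorm_cstar a : rnorm (cstar a) = rnorm a.
Proof.
suff le b : rnorm b <= rnorm (cstar b).
  by apply/eqP; rewrite eq_le le andbT -{2}(cstarK a) le.
have [->|b0] := eqVneq (rnorm b) 0; first exact: rnorm_ge0.
have bgt : 0 < rnorm b by rewrite lt_neqAle eq_sym b0 rnorm_ge0.
by rewrite -(ler_pM2r bgt) -expr2 -rnorm_csqr rnorm_cmul.
Qed.

Lemma csqr_eq0 a : cmul (cstar a) a = 0 -> a = 0.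
Proof.
move=> h; apply: rnorm0_eq0; apply/eqP.
by rewrite -sqrf_eq0 -rnorm_csqr h rnorm0.
Qed.

(** Take y = a - b and apply the C*-identity. In the absence of a unit this is how elements of A are
    told apart. *)
Lemma cmul_eql a b : (forall y, cmul (cstar a) y = cmul (cstar b) y) -> a = b.
Proof.
move=> h; apply/eqP; rewrite -subr_eq0; apply/eqP/csqr_eq0.
by rewrite cstarB cmulBl h subrr.
Qed.

(* Adjointable operators on A seen as a Hilbert module over itself; they form
   a unital C*-algebra containing A. *)
Record aop := Aop {
  aopf :> A -> A;
  aopg : A -> A;
  aop_adj : forall x y, cmul (cstar (aopf x)) y = cmul (cstar x) (aopg y);
  aop_bounded : exists M, forall x, rnorm (aopf x) <= M * rnorm x }.

Lemma aop_adj' (f : aop) x y :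
  cmul (cstar (aopg f x)) y = cmul (cstar x) (f y).
Proof. by rewrite -[LHS]cstarK cstarM cstarK -aop_adj cstarM !cstarK. Qed.

Lemma aopP (f g : aop) : (forall x, f x = g x) -> f = g.
Proof.
case: f g => [f f' hf bf] [g g' hg bg] /= fg.
have {}fg : f = g by apply/funext.
have fg' : f' = g'.
  apply/funext => y; apply: cmul_eql => z.
  have hf' := aop_adj' (Aop hf bf) y z; have hg' := aop_adj' (Aop hg bg) y z.
  by move: hf' hg' => /= -> ->; rewrite fg.
by subst; congr Aop; exact: Prop_irrelevance.
Qed.

(** Linearity need not be a field of the record: moving f to the other side of the pairing leaves an
    expression conjugate linear in the argument of f. *)
Lemma aop_lin (f : aop) (l : R[i]) x y : f (l *: x + y) = l *: f x + f y.
Proof.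
by apply: cmul_eql => z; rewrite !(aop_adj, cstarD, cstarZ, cmulDl, cmulZl).
Qed.

Lemma aopD (f : aop) x y : f (x + y) = f x + f y.
Proof. by have := aop_lin f 1 x y; rewrite !scale1r. Qed.

Lemma aop0 (f : aop) : f 0 = 0.
Proof. by have /(congr1 (fun z => z - f 0)) := aopD f 0 0; rewrite addr0 subrr addrK. Qed.

Lemma aopZ (f : aop) (l : R[i]) x : f (l *: x) = l *: f x.
Proof. by have := aop_lin f l x 0; rewrite addr0 aop0 addr0. Qed.

(** Stands for an operator norm of at most M; the norm itself, a supremum, is never formed. *)
Definition bnd (M : R) (f : aop) := forall x, rnorm (f x) <= M * rnorm x.

Lemma aop_bnd_gt0 (f : aop) : exists2 M, 0 < M & bnd M f.
Proof.
have [M hM] := aop_bounded f; exists (Num.max M 1).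
  by rewrite lt_max ltr01 orbT.
move=> x; apply: le_trans (hM x) _.
by rewrite ler_wpM2r ?rnorm_ge0 // le_max lexx.
Qed.

(** |f* y|^2 = |<f f* y, y>| <= M |f* y| |y|, then divide by |f* y|. *)
Lemma aopg_bnd M (f : aop) : 0 <= M -> bnd M f ->
  forall x, rnorm (aopg f x) <= M * rnorm x.
Proof.
move=> M0 hM y.
have [->|b0] := eqVneq (rnorm (aopg f y)) 0.
  by rewrite mulr_ge0 ?rnorm_ge0.
have bgt : 0 < rnorm (aopg f y) by rewrite lt_neqAle eq_sym b0 rnorm_ge0.
rewrite -(ler_pM2r bgt) -expr2 -rnorm_csqr -aop_adj.
apply: le_trans (rnorm_cmul _ _) _; rewrite rnorm_cstar mulrAC.
by rewrite ler_wpM2r ?rnorm_ge0.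
Qed.

Fact aop_star_bounded (f : aop) :
  exists M, forall x, rnorm (aopg f x) <= M * rnorm x.
Proof.
have [M M0 hM] := aop_bnd_gt0 f.
by exists M; apply: aopg_bnd => //; exact: ltW.
Qed.

Definition astar (f : aop) : aop := Aop (aop_adj' f) (aop_star_bounded f).

Fact aop_add_adj (f g : aop) x y :
  cmul (cstar (f x + g x)) y = cmul (cstar x) (aopg f y + aopg g y).
Proof. by rewrite cstarD cmulDl cmulDr !aop_adj. Qed.
Fact aop_add_bounded (f g : aop) :
  exists M, forall x, rnorm (f x + g x) <= M * rnorm x.
Proof.
have [M hM] := aop_bounded f; have [N hN] := aop_bounded g.
exists (M + N) => x; apply: le_trans (rnormD _ _) _.
by rewrite mulrDl lerD.
Qed.
Definition aop_add f g := Aop (aop_add_adj f g) (aop_add_bounded f g).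

Fact aop_scale_adj (l : R[i]) (f : aop) x y :
  cmul (cstar (l *: f x)) y = cmul (cstar x) (conjc l *: aopg f y).
Proof. by rewrite cstarZ cmulZl cmulZr aop_adj. Qed.
Fact aop_scale_bounded (l : R[i]) (f : aop) :
  exists M, forall x, rnorm (l *: f x) <= M * rnorm x.
Proof.
have [M hM] := aop_bounded f; exists (complex.Re `|l| * M) => x.
by rewrite rnormZ -mulrA ler_wpM2l // -[X in 0 <= X]/(rnorm (l : R[i]^o)) rnorm_ge0.
Qed.
Definition aop_scale l f := Aop (aop_scale_adj l f) (aop_scale_bounded l f).

Fact aop_mul_adj (f g : aop) x y :
  cmul (cstar (f (g x))) y = cmul (cstar x) (aopg g (aopg f y)).
Proof. by rewrite !aop_adj. Qed.
Fact aop_mul_bounded (f g : aop) :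
  exists M, forall x, rnorm (f (g x)) <= M * rnorm x.
Proof.
have [M M0 hM] := aop_bnd_gt0 f; have [N _ hN] := aop_bnd_gt0 g.
exists (M * N) => x; apply: le_trans (hM _) _.
by rewrite -mulrA ler_pM2l.
Qed.
Definition aop_mul f g := Aop (aop_mul_adj f g) (aop_mul_bounded f g).

Fact aop_one_bounded : exists M, forall x : A, rnorm x <= M * rnorm x.
Proof. by exists 1 => x; rewrite mul1r. Qed.
Definition aop_one := Aop (fun x y => erefl) aop_one_bounded.

HB.instance Definition _ := gen_eqMixin aop.
HB.instance Definition _ := gen_choiceMixin aop.

Fact aop_addA : associative aop_add.
Proof. by move=> f g h; apply: aopP => x /=; rewrite addrA. Qed.
Fact aop_addC : commutative aop_add.
Proof. by move=> f g; apply: aopP => x /=; rewrite addrC. Qed.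
Fact aop_add0 : left_id (aop_scale 0 aop_one) aop_add.
Proof. by move=> f; apply: aopP => x /=; rewrite scale0r add0r. Qed.
Fact aop_addN : left_inverse (aop_scale 0 aop_one) (aop_scale (-1)) aop_add.
Proof. by move=> f; apply: aopP => x /=; rewrite scale0r scaleN1r addNr. Qed.
HB.instance Definition _ :=
  GRing.isZmodule.Build aop aop_addA aop_addC aop_add0 aop_addN.

Fact aop_mulA : associative aop_mul.
Proof. by move=> f g h; apply: aopP. Qed.
Fact aop_mul1l : left_id aop_one aop_mul.
Proof. by move=> f; apply: aopP. Qed.
Fact aop_mul1r : right_id aop_one aop_mul.
Proof. by move=> f; apply: aopP. Qed.
Fact aop_mulDl : left_distributive aop_mul +%R.
Proof. by move=> f g h; apply: aopP. Qed.
Fact aop_mulDr : right_distributive aop_mul +%R.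
Proof. by move=> f g h; apply: aopP => x /=; rewrite aopD. Qed.
HB.instance Definition _ := GRing.Zmodule_isPzRing.Build aop
  aop_mulA aop_mul1l aop_mul1r aop_mulDl aop_mulDr.

Fact aop_scaleA (l m : R[i]) f :
  aop_scale l (aop_scale m f) = aop_scale (l * m) f.
Proof. by apply: aopP => x /=; rewrite scalerA. Qed.
Fact aop_scale1 : left_id 1 aop_scale.
Proof. by move=> f; apply: aopP => x /=; rewrite scale1r. Qed.
Fact aop_scaleDr : right_distributive aop_scale +%R.
Proof. by move=> l f g; apply: aopP => x /=; rewrite scalerDr. Qed.
Fact aop_scaleDl f : {morph aop_scale^~ f : l m / l + m}.
Proof. by move=> l m; apply: aopP => x /=; rewrite scalerDl. Qed.
HB.instance Definition _ := GRing.Zmodule_isLmodule.Build R[i] aop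
  aop_scaleA aop_scale1 aop_scaleDr aop_scaleDl.

Implicit Types f g h : aop.

Lemma aopfD f g x : (f + g) x = f x + g x. Proof. by []. Qed.
Lemma aopfM f g x : (f * g) x = f (g x). Proof. by []. Qed.
Lemma aopfZ (l : R[i]) f x : (l *: f) x = l *: f x. Proof. by []. Qed.
Lemma aopfN f x : (- f) x = - f x.
Proof. by rewrite -(scaleN1r f) aopfZ scaleN1r. Qed.
Lemma aopfB f g x : (f - g) x = f x - g x.
Proof. by rewrite aopfD aopfN. Qed.
Lemma aopf1 x : (1 : aop) x = x. Proof. by []. Qed.
Lemma aopf0 x : (0 : aop) x = 0.
Proof. by have := aopfZ 0 1 x; rewrite !scale0r. Qed.

Definition aopE := (aopfB, aopfD, aopfM, aopfZ, aopfN, aopf1, aopf0).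

Lemma aop_scaleAl (l : R[i]) f g : (l *: f) * g = l *: (f * g).
Proof. exact: aopP. Qed.
Lemma aop_scaleAr (l : R[i]) f g : f * (l *: g) = l *: (f * g).
Proof. by apply: aopP => x; rewrite !aopE aopZ. Qed.

Lemma astarK f : astar (astar f) = f.
Proof. exact: aopP. Qed.
Lemma astarM f g : astar (f * g) = astar g * astar f.
Proof. exact: aopP. Qed.
Lemma astarD f g : astar (f + g) = astar f + astar g.
Proof. exact: aopP. Qed.
Lemma astarZ (l : R[i]) f : astar (l *: f) = conjc l *: astar f.
Proof. exact: aopP. Qed.
Lemma astarMr (t : R) f : astar (t%:C *: f) = t%:C *: astar f.
Proof. by rewrite astarZ conjc_real. Qed.
Lemma astarN f : astar (- f) = - astar f.
Proof. by rewrite -scaleN1r astarZ rmorphN1 scaleN1r. Qed.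
Lemma astarB f g : astar (f - g) = astar f - astar g.
Proof. by rewrite astarD astarN. Qed.
Lemma astar1 : astar 1 = 1.
Proof. exact: aopP. Qed.

Lemma bndD M N f g : bnd M f -> bnd N g -> bnd (M + N) (f + g).
Proof.
move=> hf hg x; rewrite aopfD; apply: le_trans (rnormD _ _) _.
by rewrite mulrDl lerD.
Qed.
Lemma bndM M N f g : 0 <= M -> bnd M f -> bnd N g -> bnd (M * N) (f * g).
Proof.
move=> M0 hf hg x; apply: le_trans (hf _) _.
by rewrite -mulrA ler_wpM2l.
Qed.
Lemma bndZ (t : R) M f : bnd M f -> bnd (`|t| * M) (t%:C *: f).
Proof. by move=> hf x; rewrite aopfZ rnormMr -mulrA ler_wpM2l. Qed.
Lemma bndN M f : bnd M f -> bnd M (- f).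
Proof. by move=> hf x; rewrite aopfN rnormN. Qed.
Lemma bnd1 : bnd 1 1.
Proof. by move=> x; rewrite mul1r. Qed.
Lemma bnd00 : bnd 0 0.
Proof. by move=> x; rewrite aopf0 rnorm0 mul0r. Qed.
Lemma bnd_le M N f : M <= N -> bnd M f -> bnd N f.
Proof.
by move=> MN hf x; apply: le_trans (hf x) _; rewrite ler_wpM2r ?rnorm_ge0.
Qed.
Lemma bnd0_eq0 f : bnd 0 f -> f = 0.
Proof.
move=> h; apply: aopP => x; rewrite aopf0; apply: rnorm0_eq0.
by apply/eqP; rewrite eq_le rnorm_ge0 andbT -[leRHS](mul0r (rnorm x)).
Qed.

Lemma bnd_astar M f : 0 <= M -> bnd M f -> bnd M (astar f).
Proof. exact: aopg_bnd. Qed.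

(** The C*-identity for operators: |f x|^2 = |<x, f* f x>| <= M^2 |x|^2. *)
Lemma bnd_sqr M f : 0 <= M -> bnd (M ^+ 2) (astar f * f) -> bnd M f.
Proof.
move=> M0 h x; rewrite -ler_sqr ?nnegrE ?rnorm_ge0 ?mulr_ge0 ?rnorm_ge0 //.
rewrite -rnorm_csqr aop_adj; apply: le_trans (rnorm_cmul _ _) _.
rewrite rnorm_cstar mulrC exprMn [rnorm x ^+ 2]expr2 mulrA ler_wpM2r ?rnorm_ge0 //.
exact: h.
Qed.

Lemma aop_star_sqr_eq0 f : astar f * f = 0 -> f = 0.
Proof.
move=> h; apply/bnd0_eq0/bnd_sqr => //; rewrite h => x.
by rewrite aopf0 rnorm0 expr0n mul0r.
Qed.

End CStarBasics.

(** * Positivity in a C*-algebra *)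

Section Positivity.
Variables (R : realType) (A : cstarAlgType R).
Notation aop := (aop A).
Implicit Types f g h w : aop.

Lemma small_le0 (C x : R) (e : nat -> R) : 0 <= C ->
  (forall d, 0 < d -> exists n, e n < d) -> (forall n, x <= C * e n) -> x <= 0.
Proof.
move=> C0 e0 h; rewrite leNgt; apply/negP => x0.
have [n hn] := e0 (x / (C + 1)) (divr_gt0 x0 (ltr_wpDl C0 ltr01)).
have := h n; rewrite leNgt => /negP; apply.
rewrite ltr_pdivlMr ?ltr_wpDl // in hn.
have [/eqP|en0] := ltP (e n) 0; nra.
Qed.

Lemma aop_pointwise_limit (u : nat -> aop) (e : nat -> R) :
  (forall n, 0 <= e n) -> (forall d, 0 < d -> exists n, e n < d) ->
  (forall n m, (n <= m)%N -> bnd (e n) (u m - u n)) ->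
  exists l : A -> A, forall n x, rnorm (l x - u n x) <= e n * rnorm x.
Proof.
move=> e_ge0 e0 uC.
have uC' n m x : (n <= m)%N -> rnorm (u m x - u n x) <= e n * rnorm x.
  by move=> nm; rewrite -aopfB; exact: uC.
have [x|l hl] := @choice _ _ (fun x l => forall d : R, 0 < d ->
   exists N, forall n, (N <= n)%N -> rnorm (u n x - l) < d).
  apply: rnorm_complete => d d0.
  have x1 : 0 < 2 * (rnorm x + 1) by rewrite mulr_gt0 // ltr_wpDl ?rnorm_ge0.
  have [N hN] := e0 (d / (2 * (rnorm x + 1))) (divr_gt0 d0 x1).
  rewrite ltr_pdivlMr // in hN.
  exists N => m n Nm Nn.
  have hm := uC' N m x Nm; have hn := uC' N n x Nn.
  have := rnormB (u m x - u N x) (u n x - u N x).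
  rewrite opprB addrA subrK.
  have := e_ge0 N; have := rnorm_ge0 x; nra.
exists l => n x; apply/ler_addgt0Pr => d d0.
have [N hN] := hl x d d0.
have hm := hN (maxn N n) (leq_maxl _ _).
have hn := uC' n (maxn N n) x (leq_maxr _ _).
have := rnormB (u (maxn N n) x - u n x) (u (maxn N n) x - l x).
rewrite opprB addrC addrA subrK; lra.
Qed.

(** [astar] preserves bounds, so the adjoints converge as well, and their limit is an adjoint of the
    limit. *)
Lemma aop_limit (u : nat -> aop) (e : nat -> R) :
  (forall n, 0 <= e n) -> (forall d, 0 < d -> exists n, e n < d) ->
  (forall n m, (n <= m)%N -> bnd (e n) (u m - u n)) ->
  exists f, forall n, bnd (e n) (f - u n).
Proof.
move=> e_ge0 e0 uC.
have [l hl] := aop_pointwise_limit e_ge0 e0 uC.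
have [n m nm|l' hl'] := @aop_pointwise_limit (fun n => astar (u n)) e e_ge0 e0.
  by rewrite -astarB; apply: bnd_astar => //; exact: uC.
have l_adj x y : cmul (cstar (l x)) y = cmul (cstar x) (l' y).
  apply/eqP; rewrite -subr_eq0; apply/eqP/rnorm0_eq0/eqP.
  rewrite eq_le rnorm_ge0 andbT.
  apply: (small_le0 (C := 2 * (rnorm x * rnorm y)) _ e0) => [|n].
    by rewrite !mulr_ge0 ?rnorm_ge0.
  have -> : cmul (cstar (l x)) y - cmul (cstar x) (l' y) =
     cmul (cstar (l x - u n x)) y - cmul (cstar x) (l' y - astar (u n) y).
    by rewrite cstarB cmulBl cmulBr aop_adj opprB addrA subrK.
  apply: le_trans (rnormB _ _) _.
  have h1 := rnorm_cmul (cstar (l x - u n x)) y.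
  have h2 := rnorm_cmul (cstar x) (l' y - astar (u n) y).
  rewrite !rnorm_cstar in h1 h2.
  have h3 := hl n x; have h4 := hl' n y.
  have := rnorm_ge0 x; have := rnorm_ge0 y; nra.
have l_bnd : exists M, forall x, rnorm (l x) <= M * rnorm x.
  have [M M0 hM] := aop_bnd_gt0 (u 0%N).
  exists (e 0%N + M) => x; have h1 := hl 0%N x; have h2 := hM x.
  have := rnormD (l x - u 0%N x) (u 0%N x); rewrite subrK; nra.
by exists (Aop l_adj l_bnd) => n x; rewrite aopfB; exact: hl.
Qed.

Lemma bnd_small_eq0 (C : R) (e : nat -> R) f : 0 <= C ->
  (forall d, 0 < d -> exists n, e n < d) -> (forall n, bnd (C * e n) f) ->
  f = 0.
Proof.
move=> C0 e0 h; apply: bnd0_eq0 => x; rewrite mul0r.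
apply: (small_le0 (C := C * rnorm x) _ e0) => [|n].
  by rewrite mulr_ge0 ?rnorm_ge0.
by rewrite mulrAC h.
Qed.

(** * Square roots of operators by iteration *)

Section SquareRoot.

(* The iterates increase to 1 - sqrt (1 - f); as polynomials in f with nonnegative
   coefficients they are dominated by their value [sqrt_bnd] at f = 1. *)
Definition sqrt_step f (y : aop) : aop := (2^-1)%:C *: (f + y * y).
Definition sqrt_seq f (n : nat) : aop := iter n (sqrt_step f) 0.
Definition sqrt_bnd (n : nat) : R := iter n (fun s => 2^-1 * (1 + s ^+ 2)) 0.

Lemma sqrt_bndS n : sqrt_bnd n.+1 = 2^-1 * (1 + sqrt_bnd n ^+ 2).
Proof. by []. Qed.

Lemma sqrt_seqS f n :
  sqrt_seq f n.+1 = (2^-1)%:C *: (f + sqrt_seq f n * sqrt_seq f n).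
Proof. by []. Qed.

Lemma sqrt_bnd01 n : 0 <= sqrt_bnd n <= 1.
Proof.
elim: n => [|n /andP[h0 h1]]; first by rewrite /sqrt_bnd /= lexx ler01.
by rewrite sqrt_bndS; apply/andP; split; nra.
Qed.

Lemma sqrt_bnd_le n m : (n <= m)%N -> sqrt_bnd n <= sqrt_bnd m.
Proof.
elim: m => [|m IH]; first by rewrite leqn0 => /eqP->.
rewrite leq_eqVlt => /predU1P[->//|/IH/le_trans]; apply.
by have /andP[h0 h1] := sqrt_bnd01 m; rewrite sqrt_bndS; nra.
Qed.

Lemma sqrt_bnd_cvg1 (d : R) : 0 < d -> exists n, 1 - sqrt_bnd n < d.
Proof.
move=> d0.
(* The defect r = 1 - [sqrt_bnd n] obeys r' = r - r^2 / 2, hence decays like 2 / n; the shift by 2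
   fits the value r = 1 at n = 0. *)
have bound n : (n%:R + 2) * (1 - sqrt_bnd n) <= 2.
  elim: n => [|n IH]; first by rewrite /sqrt_bnd /= add0r subr0 mulr1.
  have n0 : 0 <= n%:R :> R by [].
  have /andP[h0 h1] := sqrt_bnd01 n.
  rewrite sqrt_bndS -[n.+1%:R]natr1.
  set N := n%:R in n0 IH *; set s := sqrt_bnd n in h0 h1 IH *.
  pose a := (N + 2) * (1 - s).
  have a2 : a <= 2 by [].
  (* (N + 2)^2 (1 - s^2) = a (2 (N + 2) - a) is at most its value 4 (N + 1) at a = 2, and (N + 1) (N
     + 3) <= (N + 2)^2. *)
  have h : 0 <= (2 - a) * (2 * (N + 2) - 2 - a) by apply: mulr_ge0; lra.
  have h' : 0 <= (N + 3) * ((2 - a) * (2 * (N + 2) - 2 - a)).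
    by apply: mulr_ge0 => //; lra.
  have e : (N + 3) * ((2 - a) * (2 * (N + 2) - 2 - a)) =
    (N + 3) * 4 * (N + 1) - (N + 2) ^+ 2 * ((N + 3) * (1 - s ^+ 2)).
    by rewrite /a; ring.
  have N2 : 0 < (N + 2) ^+ 2 by rewrite exprn_gt0 //; lra.
  have : (N + 3) * (1 - s ^+ 2) <= 4.
    rewrite -(ler_pM2l N2); nra.
  nra.
have [n hn] : exists n : nat, 2 / d < n%:R.
  by exists (Num.truncn (2 / d)).+1; rewrite truncnS_gt.
exists n; have := bound n; rewrite ltr_pdivrMr // in hn.
have /andP[h0 h1] := sqrt_bnd01 n; have n0 : 0 <= n%:R :> R by [].
rewrite leNgt => /negP h; rewrite ltNge; apply/negP => h'; apply: h; nra.
Qed.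

Lemma sqrt_seq_comm f g n : g * f = f * g ->
  g * sqrt_seq f n = sqrt_seq f n * g.
Proof.
move=> gf; elim: n => [|n IH]; first by rewrite /sqrt_seq /= mulr0 mul0r.
rewrite sqrt_seqS aop_scaleAr aop_scaleAl mulrDr mulrDl gf.
by rewrite mulrA IH -mulrA IH mulrA.
Qed.

Lemma sqrt_seq_sa f n : astar f = f -> astar (sqrt_seq f n) = sqrt_seq f n.
Proof.
move=> sf; elim: n => [|n IH]; last by rewrite sqrt_seqS astarMr astarD astarM IH sf.
by rewrite /sqrt_seq /= -(scale0r (0 : aop)) astarZ conjc0 !scale0r.
Qed.

Lemma sqrt_seq_bnd f n : bnd 1 f -> bnd (sqrt_bnd n) (sqrt_seq f n).
Proof.
move=> f1; elim: n => [|n IH].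
  exact: bnd00.
rewrite sqrt_seqS sqrt_bndS -[2^-1 in X in bnd X _]ger0_norm //.
apply/bndZ/bndD => //; apply: bndM => //.
by have /andP[] := sqrt_bnd01 n.
Qed.

Lemma comm_sqrB f g : f * g = g * f -> f * f - g * g = (f - g) * (f + g).
Proof. by move=> fg; rewrite mulrBl !mulrDr fg opprD addrA addrK. Qed.

(** The iterates commute, so a difference of consecutive squares factors; the scalar sequence
    factors in the same way. *)
Lemma sqrt_seq_step_bnd f n : bnd 1 f ->
  bnd (sqrt_bnd n.+1 - sqrt_bnd n) (sqrt_seq f n.+1 - sqrt_seq f n).
Proof.
move=> f1; elim: n => [|n IH].
  rewrite [sqrt_seq _ 0]/(0 : aop) [sqrt_bnd 0]/0 !subr0.
  exact: sqrt_seq_bnd.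
have comm : sqrt_seq f n.+1 * sqrt_seq f n = sqrt_seq f n * sqrt_seq f n.+1.
  by apply/esym/sqrt_seq_comm/esym/sqrt_seq_comm.
have -> : sqrt_seq f n.+2 - sqrt_seq f n.+1 = (2^-1)%:C *:
    ((sqrt_seq f n.+1 - sqrt_seq f n) * (sqrt_seq f n.+1 + sqrt_seq f n)).
  rewrite -comm_sqrB // -[in LHS]/(sqrt_step f _) -[X in _ - X]/(sqrt_step f _).
  by rewrite /sqrt_step -scalerBr opprD addrACA subrr add0r.
have -> : sqrt_bnd n.+2 - sqrt_bnd n.+1 =
  `|2^-1| * ((sqrt_bnd n.+1 - sqrt_bnd n) * (sqrt_bnd n.+1 + sqrt_bnd n)).
  by rewrite ger0_norm // sqrt_bndS [X in _ - X]sqrt_bndS; ring.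
apply/bndZ/bndM => //; first by rewrite subr_ge0 sqrt_bnd_le.
by apply: bndD; exact: sqrt_seq_bnd.
Qed.

Lemma sqrt_seq_cauchy f n m : bnd 1 f -> (n <= m)%N ->
  bnd (1 - sqrt_bnd n) (sqrt_seq f m - sqrt_seq f n).
Proof.
move=> f1 nm.
apply: (@bnd_le _ _ (sqrt_bnd m - sqrt_bnd n)).
  by rewrite lerB //; have /andP[] := sqrt_bnd01 m.
elim: m nm => [|m IH].
  by rewrite leqn0 => /eqP ->; rewrite !subrr; exact: bnd00.
rewrite leq_eqVlt => /predU1P[->|/IH h].
  by rewrite !subrr; exact: bnd00.
rewrite -[sqrt_seq f m.+1](subrK (sqrt_seq f m)) -addrA.
rewrite -[sqrt_bnd m.+1](subrK (sqrt_bnd m)) -addrA.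
by apply: bndD => //; exact: sqrt_seq_step_bnd.
Qed.

(** The limit Y of the iterates solves 2 Y = f + Y^2, that is, (1 - Y)^2 = 1 - f. The commutation
    clause stands in for functional calculus later. *)
Lemma aop_sqrt f : astar f = f -> bnd 1 f ->
  exists w, [/\ astar w = w, bnd 1 (1 - w), w * w = 1 - f &
    forall g, g * f = f * g -> g * w = w * g].
Proof.
move=> sf f1.
have e_ge0 n : 0 <= 1 - sqrt_bnd n.
  by rewrite subr_ge0; have /andP[] := sqrt_bnd01 n.
have [Y hY] := aop_limit e_ge0 sqrt_bnd_cvg1
  (fun n m nm => @sqrt_seq_cauchy f n m f1 nm).
have small C g : 0 <= C -> (forall n, bnd (C * (1 - sqrt_bnd n)) g) -> g = 0.
  by move=> C0; apply: bnd_small_eq0 => //; exact: sqrt_bnd_cvg1.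
have Y1 : bnd 1 Y.
  rewrite -[1](subrK (sqrt_bnd 0)) -[Y](subrK (sqrt_seq f 0)).
  by apply: bndD => //; exact: sqrt_seq_bnd.
have sY : astar Y = Y.
  apply/eqP; rewrite -subr_eq0; apply/eqP/(small 2) => // n.
  have -> : astar Y - Y = astar (Y - sqrt_seq f n) - (Y - sqrt_seq f n).
    by rewrite astarB sqrt_seq_sa // opprB addrA subrK.
  rewrite mulr_natl mulr2n; apply: bndD; last exact: bndN.
  exact: bnd_astar.
have cY g : g * f = f * g -> g * Y = Y * g.
  move=> gf; apply/eqP; rewrite -subr_eq0; apply/eqP.
  have [M M0 hM] := aop_bnd_gt0 g.
  apply: (small (M + M)); first by rewrite addr_ge0 ?ltW.
  move=> n.
  have -> : g * Y - Y * g = g * (Y - sqrt_seq f n) - (Y - sqrt_seq f n) * g.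
    by rewrite mulrBr mulrBl (sqrt_seq_comm n gf) opprB addrA subrK.
  rewrite mulrDl; apply: bndD; first by apply: bndM => //; exact: ltW.
  by apply: bndN; rewrite mulrC; exact: bndM.
have eY : Y = (2^-1)%:C *: (f + Y * Y).
  apply/eqP; rewrite -subr_eq0; apply/eqP/(small 2) => // n.
  have cYn : Y * sqrt_seq f n = sqrt_seq f n * Y.
    by apply/esym/cY/esym/sqrt_seq_comm.
  have -> : Y - (2^-1)%:C *: (f + Y * Y) = (Y - sqrt_seq f n.+1) -
      (2^-1)%:C *: ((Y - sqrt_seq f n) * (Y + sqrt_seq f n)).
    rewrite -comm_sqrB // sqrt_seqS -addrA -opprD -scalerDr; congr (_ - _ *: _).
    by rewrite addrA addrAC addrK.
  apply: (@bnd_le _ _ (1 - sqrt_bnd n.+1 +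
      `|2^-1| * ((1 - sqrt_bnd n) * (1 + 1)))).
    have := sqrt_bnd_le (leqnSn n); rewrite ger0_norm //; lra.
  apply: bndD => //; apply/bndN/bndZ/bndM => //.
  apply: bndD => //; apply: (bnd_le _ (sqrt_seq_bnd n f1)).
  by have /andP[] := sqrt_bnd01 n.
have eY2 : f + Y * Y = Y + Y.
  rewrite [in RHS]eY -scalerDl -rmorphD /=.
  have -> : 2^-1 + 2^-1 = 1 :> R by lra.
  by rewrite scale1r.
exists (1 - Y); split.
- by rewrite astarB astar1 sY.
- by rewrite opprB addrC subrK.
- rewrite mulrBl mul1r mulrBr mulr1 -addrA -opprD.
  congr (1 - _); apply/eqP; rewrite addrA subr_eq eq_sym; apply/eqP; exact: eY2.
- by move=> g gf; rewrite mulrBl mulrBr mul1r mulr1 cY.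
Qed.

End SquareRoot.
Local Notation Id := (1 : aop).

(** In this form, stability under sums is just the triangle inequality. For selfadjoint g the bound
    says that the spectrum lies in [0, 2 t]. *)
Definition apositive g := astar g = g /\
  exists2 t : R, 0 <= t & bnd t (t%:C *: Id - g).

Lemma bnd_scalar (t : R) : 0 <= t -> bnd t (t%:C *: Id).
Proof.
move=> t0; rewrite -[t in bnd t _]mulr1 -[t in bnd (t * _) _]ger0_norm //.
exact/bndZ/bnd1.
Qed.

Lemma scale_real_sqr (t : R) f : (t%:C *: f) * (t%:C *: f) = (t ^+ 2)%:C *: (f * f).
Proof. by rewrite aop_scaleAl aop_scaleAr scalerA -rmorphM. Qed.

Lemma apositiveD f g : apositive f -> apositive g -> apositive (f + g).
Proof.
move=> [sf [t t0 ht]] [sg [s s0 hs]]; split; first by rewrite astarD sf sg.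
exists (t + s); first exact: addr_ge0.
by rewrite rmorphD scalerDl opprD addrACA; exact: bndD.
Qed.

Lemma apositiveZ (t : R) f : 0 <= t -> apositive f -> apositive (t%:C *: f).
Proof.
move=> t0 [sf [s s0 hs]]; split; first by rewrite astarMr sf.
exists (t * s); first exact: mulr_ge0.
rewrite rmorphM -scalerA -scalerBr -[t in bnd (t * _) _]ger0_norm //.
exact: bndZ.
Qed.

Lemma apositive_sqrt g : apositive g ->
  exists h, [/\ apositive h, h * h = g & forall k, k * g = g * k -> k * h = h * k].
Proof.
move=> [sg [t t0 ht]].
(* t may be 0, while the normalisation of g divides by the bound. *)
have {}ht : bnd (t + 1) ((t + 1)%:C *: Id - g).
  rewrite rmorphD scalerDl addrAC scale1r; apply: bndD => //; exact: bnd1.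
set s := t + 1 in ht; have s0 : 0 < s by rewrite /s; lra.
have ss : s%:C * (s^-1)%:C = 1 :> R[i] by rewrite -rmorphM /= divff ?gt_eqF.
pose f := 1 - (s^-1)%:C *: g.
have sf : astar f = f by rewrite astarB astar1 astarMr sg.
have f1 : bnd 1 f.
  have -> : f = (s^-1)%:C *: (s%:C *: Id - g).
    by rewrite scalerBr scalerA mulrC ss scale1r.
  rewrite -[X in bnd X _](mulVf (lt0r_neq0 s0)) -[X in bnd (X * _) _]ger0_norm.
    exact: bndZ.
  by rewrite invr_ge0 ltW.
have [w [sw w1 ww cw]] := aop_sqrt sf f1.
exists ((Num.sqrt s)%:C *: w); split.
- split; first by rewrite astarMr sw.
  exists (Num.sqrt s); first exact: sqrtr_ge0.
  rewrite -scalerBr -[X in bnd X _]mulr1 -[X in bnd (X * _) _]ger0_norm ?sqrtr_ge0 //.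
  exact: bndZ.
- rewrite scale_real_sqr sqr_sqrtr ?ltW // ww /f opprB addrC subrK.
  by rewrite scalerA ss scale1r.
- move=> k kg; rewrite aop_scaleAr aop_scaleAl cw //.
  by rewrite /f mulrBl mulrBr mul1r mulr1 aop_scaleAr aop_scaleAl kg.
Qed.

(* h + i w is normal with modulus r, and h is the average of it and its adjoint. *)
Lemma bnd_sqrD_comm (r : R) h w : 0 <= r -> astar h = h -> astar w = w ->
  h * w = w * h -> h * h + w * w = (r ^+ 2)%:C *: Id -> bnd r h.
Proof.
move=> r0 sh sw hw e; pose u := h + 'i%C *: w.
have su : astar u = h - 'i%C *: w.
  by rewrite astarD astarZ sh sw -scaleNr; congr (_ + _ *: _); simpc.
have ur : bnd r u.
  apply: bnd_sqr => //.
  have -> : astar u * u = (r ^+ 2)%:C *: Id.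
    rewrite su /u mulrBl !mulrDr !aop_scaleAl !aop_scaleAr hw opprD addrA addrK.
    rewrite scalerA -e; congr (_ + _); rewrite -[RHS]scale1r -scaleNr.
    by congr (_ *: _); rewrite -expr2 sqr_i opprK.
  exact/bnd_scalar/exprn_ge0.
have -> : h = (2^-1)%:C *: (u + astar u).
  rewrite su /u addrACA subrr addr0 scalerDr -scalerDl -rmorphD /=.
  have -> : 2^-1 + 2^-1 = 1 :> R by lra.
  by rewrite scale1r.
have -> : r = `|2^-1| * (r + r) by rewrite ger0_norm //; lra.
exact/bndZ/bndD/bnd_astar.
Qed.

(** Scale h to a contraction k and let w be a root of 1 - k^2. Since k and w commute and k^2 + w^2 =
    1, w is a contraction too, and M^2 - h^2 = M^2 w^2 has norm at most M^2. *)
Lemma apositive_sqr h : astar h = h -> apositive (h * h).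
Proof.
move=> sh; have [M M0 hM] := aop_bnd_gt0 h.
have MM : M%:C * (M^-1)%:C = 1 :> R[i] by rewrite -rmorphM /= divff ?gt_eqF.
pose k := (M^-1)%:C *: h.
have sk : astar k = k by rewrite astarMr sh.
have k1 : bnd 1 k.
  rewrite -[X in bnd X _](mulVf (lt0r_neq0 M0)) -[X in bnd (X * _) _]ger0_norm.
    exact: bndZ.
  by rewrite invr_ge0 ltW.
have [|| w [sw _ ww cw]] := @aop_sqrt (k * k).
- by rewrite astarM sk.
- by rewrite -[X in bnd X _]mulr1; exact: bndM.
have kw : k * w = w * k by apply: cw; rewrite mulrA.
have w1 : bnd 1 w.
  apply: (@bnd_sqrD_comm _ w k) => //.
  by rewrite ww subrK expr1n scale1r.
split; first by rewrite astarM sh.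
exists (M ^+ 2); first exact: sqr_ge0.
have -> : (M ^+ 2)%:C *: Id - h * h = (M ^+ 2)%:C *: (w * w).
  have -> : h = M%:C *: k by rewrite scalerA MM scale1r.
  by rewrite scale_real_sqr ww -scalerBr.
rewrite -[X in bnd X _]mulr1 -[X in bnd (X * _) _]ger0_norm ?sqr_ge0 //.
by apply: bndZ; rewrite -[X in bnd X _]mulr1; exact: bndM.
Qed.

Lemma apositive_scalarB (r : R) c : astar c = c -> 0 <= r -> bnd r c ->
  apositive (r%:C *: Id - c).
Proof.
move=> sc r0 rc; split; first by rewrite astarB astarMr astar1 sc.
by exists r => //; rewrite opprB addrC subrK.
Qed.

(** r - a = (r - (a + b)) + b is positive. The roots u of a and w of r - a commute and satisfy u^2 +
    w^2 = r, so |u|^2 <= r. *)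
Lemma apositive_le_bnd (r : R) a b : 0 <= r -> apositive a -> apositive b ->
  bnd r (a + b) -> bnd r a.
Proof.
move=> r0 pa pb hr.
have pc : apositive (r%:C *: Id - a).
  have -> : r%:C *: Id - a = (r%:C *: Id - (a + b)) + b.
    by rewrite opprD addrA subrK.
  apply: apositiveD => //; apply: apositive_scalarB => //.
  by rewrite astarD pa.1 pb.1.
have [u [[su _] uu cu]] := apositive_sqrt pa.
have [w [[sw _] ww cw]] := apositive_sqrt pc.
have uw : u * w = w * u.
  apply: cw; rewrite mulrBr mulrBl aop_scaleAr aop_scaleAl mulr1 mul1r.
  by rewrite -uu mulrA.
have h : bnd (Num.sqrt r) u.
  apply: (bnd_sqrD_comm _ su sw uw); first exact: sqrtr_ge0.
  by rewrite uu ww addrC subrK sqr_sqrtr.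
rewrite -uu -[r in bnd r _]sqr_sqrtr // expr2.
by apply: bndM => //; exact: sqrtr_ge0.
Qed.

Lemma apositiveD_eq0 a b : apositive a -> apositive b -> a + b = 0 -> a = 0.
Proof.
move=> pa pb ab; apply: bnd0_eq0; apply: (apositive_le_bnd _ pa pb) => //.
by rewrite ab; exact: bnd00.
Qed.

(* With q = c c* and d = p c*, both d* d = - q^2 and d d* = - p^4, whereas
   d* d + d d* is half the sum of the squares of d + d* and i (d - d* ). *)
Lemma astar_sqr_neg (c p : aop) : astar p = p -> astar c * c = - (p * p) -> c = 0.
Proof.
move=> sp ec; pose q := c * astar c; pose d := p * astar c.
have sq : astar q = q by rewrite astarM astarK.
have sd : astar d = c * p by rewrite astarM astarK sp.
have dd : astar d * d = - (q * q).
  rewrite sd /d /q mulrA -(mulrA c p p) -[p * p]opprK -ec mulrN mulNr.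
  by rewrite !mulrA.
have dd' : d * astar d = - (p * p * (p * p)).
  by rewrite sd /d mulrA -(mulrA p) ec mulrN mulNr !mulrA.
pose x := d + astar d; pose y := 'i%C *: (d - astar d).
have sx : astar x = x by rewrite astarD astarK addrC.
have sy : astar y = y.
  by rewrite astarZ astarB astarK -opprB scalerN -scaleNr; congr (_ *: _); simpc.
have xy : x * x + y * y = (astar d * d + astar d * d) + (d * astar d + d * astar d).
  rewrite [y * y]aop_scaleAl aop_scaleAr scalerA -['i%C * _]expr2 sqr_i scaleN1r.
  rewrite (mulrDr x) mulrBr opprD opprK addrACA -mulrBl -mulrDl.
  rewrite opprD opprK addrACA subrr add0r.
  by rewrite [x + _]addrACA subrr addr0 !mulrDl.
(* S is a sum of squares of selfadjoint elements and equals - 2 p^4, so p^4 and p^4 + S are positive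
   with sum 0. *)
have p4 : p * p * (p * p) = 0.
  pose S := x * x + y * y + (q * q + q * q).
  have pp4 : apositive (p * p * (p * p)).
    by apply: apositive_sqr; rewrite astarM sp.
  apply: (@apositiveD_eq0 _ (p * p * (p * p) + S)) => //.
    by apply: apositiveD => //; do ?apply: apositiveD; exact: apositive_sqr.
  rewrite /S xy dd dd' -!opprD; set Q := q * q; set P := p * p * (p * p).
  by rewrite [- (Q + Q + _)]opprD [- (Q + Q) - _ + _]addrAC addNr add0r addrA subrr.
have p2 : p * p = 0 by apply: aop_star_sqr_eq0; rewrite astarM sp.
by apply: aop_star_sqr_eq0; rewrite ec p2 oppr0.
Qed.

(** With h = f* f and q = |h|, v = q - h is twice the negative part of h. From h v = - q v the
    square of f v is minus that of r v, where r^2 = q, so [astar_sqr_neg] gives f v = 0. Then h v =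
    q v = 0, hence v^2 = 0 and h = q. *)
Lemma apositive_star_sqr f : apositive (astar f * f).
Proof.
pose h := astar f * f; have sh : astar h = h by rewrite astarM astarK.
have [q [pq qq cq]] := apositive_sqrt (apositive_sqr sh).
have [r [[sr _] rr cr]] := apositive_sqrt pq.
have hq : h * q = q * h by apply: cq; rewrite mulrA.
pose v := q - h.
have qv : q * v = v * q by rewrite mulrBl mulrBr hq.
have hv : h * v = - (q * v).
  apply/eqP; rewrite -addr_eq0 -mulrDl mulrBr !mulrDl hq qq.
  by rewrite opprD addrA addrK subrr.
have vr : v * r = r * v by apply: cr; rewrite qv.
have sv : astar v = v by rewrite astarB sh pq.1.
have fv0 : f * v = 0.
  apply: (@astar_sqr_neg _ (r * v)); first by rewrite astarM sv sr vr.
  rewrite astarM sv -mulrA (mulrA _ f) -/h hv mulrN; congr (- _).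
  by rewrite -{1}vr -[RHS]mulrA (mulrA r r) rr.
have hv0 : h * v = 0 by rewrite /h -mulrA fv0 mulr0.
have qv0 : q * v = 0 by apply/eqP; rewrite -oppr_eq0 -hv hv0.
have v0 : v = 0.
  by apply: aop_star_sqr_eq0; rewrite sv {1}/v mulrBl qv0 hv0 subrr.
by rewrite -/h; move/eqP: v0; rewrite subr_eq0 => /eqP <-.
Qed.

End Positivity.

(** * Positive elements of A, through left multiplication *)

Section PositiveElements.
Variables (R : realType) (A : cstarAlgType R).
Implicit Types a b c : A.

Fact lmul_adj a x y :
  cmul (cstar (cmul a x)) y = cmul (cstar x) (cmul (cstar a) y).
Proof. by rewrite cstarM cmulA. Qed.
Fact lmul_bounded a : exists M, forall x, rnorm (cmul a x) <= M * rnorm x.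
Proof. by exists (rnorm a) => x; exact: rnorm_cmul. Qed.
Definition lmul a : aop A := Aop (lmul_adj a) (lmul_bounded a).

Lemma lmulD a b : lmul (a + b) = lmul a + lmul b.
Proof. by apply: aopP => x; rewrite /= cmulDl. Qed.
Lemma lmulZ (l : R[i]) a : lmul (l *: a) = l *: lmul a.
Proof. by apply: aopP => x; rewrite /= cmulZl. Qed.
Lemma lmulN a : lmul (- a) = - lmul a.
Proof. by rewrite -scaleN1r lmulZ scaleN1r. Qed.
Lemma lmulM a b : lmul (cmul a b) = lmul a * lmul b.
Proof. by apply: aopP => x; rewrite /= cmulA. Qed.
Lemma lmul_star a : lmul (cstar a) = astar (lmul a).
Proof. exact: aopP. Qed.

Lemma bnd_lmul a : bnd (rnorm a) (lmul a).
Proof. by move=> x; exact: rnorm_cmul. Qed.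

(** Left multiplication is isometric: at [cstar a] the C*-identity gives |a a*| = |a|^2. *)
Lemma lmul_bnd_le M a : 0 <= M -> bnd M (lmul a) -> rnorm a <= M.
Proof.
move=> M0 /(_ (cstar a)) /=.
rewrite -{1}[a]cstarK rnorm_csqr !rnorm_cstar expr2.
have [->//|a0] := eqVneq (rnorm a) 0.
by rewrite ler_pM2r // lt_neqAle eq_sym a0 rnorm_ge0.
Qed.

(** [apositive] refers to the unit, which A may lack, hence the passage to operators. *)
Definition cpos a := apositive (lmul a).

Lemma cpos_sqr a : cpos (cmul (cstar a) a).
Proof. by rewrite /cpos lmulM lmul_star; exact: apositive_star_sqr. Qed.

Lemma cposD a b : cpos a -> cpos b -> cpos (a + b).
Proof. by rewrite /cpos lmulD; exact: apositiveD. Qed.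

Lemma cposZ (t : R) a : 0 <= t -> cpos a -> cpos (t%:C *: a).
Proof. by rewrite /cpos lmulZ; exact: apositiveZ. Qed.

Lemma rnorm_cpos_le a b : cpos a -> cpos b -> rnorm a <= rnorm (a + b).
Proof.
move=> pa pb; have n0 := rnorm_ge0 (a + b).
apply: lmul_bnd_le n0 (apositive_le_bnd n0 pa pb _).
by rewrite -lmulD; exact: bnd_lmul.
Qed.

(** |c| - c has a root h among the operators, in general outside A; the difference, as a
    multiplication operator, is the square of h [lmul a]. *)
Lemma cpos_conj a c : cpos c ->
  cpos ((rnorm c)%:C *: cmul (cstar a) a - cmul (cstar a) (cmul c a)).
Proof.
move=> pc; have : apositive ((rnorm c)%:C *: (1 : aop A) - lmul c).
  by apply: apositive_scalarB (rnorm_ge0 c) (bnd_lmul c); exact: pc.1.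
move=> /apositive_sqrt[h [[sh _] hh _]].
have := apositive_star_sqr (h * lmul a).
rewrite astarM sh -mulrA (mulrA h) hh mulrBl mulrBr aop_scaleAl mul1r aop_scaleAr.
by rewrite /cpos lmulD lmulZ lmulN !lmulM lmul_star.
Qed.

End PositiveElements.

(** * Hilbert modules *)

Section Hilbert.
Variables (R : realType) (A : cstarAlgType R).

(* Hilbert modules with positivity expressed by [cpos], which is visibly
   stable under sums; this makes E (+) E one. *)
Record hilbert (F : formModType A) : Prop := Hilbert {
  hilbert_pos : forall x : F, cpos (ip x x : A);
  hilbert_def : forall x : F, (ip x x : A) = 0 -> x = 0;
  hilbert_complete : forall u : nat -> F,
    (forall e : R, 0 < e -> exists N : nat, forall m n : nat,
       (N <= m)%N -> (N <= n)%N -> hnorm (u m - u n) < e) ->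
    exists l : F, forall e : R, 0 < e -> exists N : nat, forall n : nat,
       (N <= n)%N -> hnorm (u n - l) < e }.

Lemma hilbertMod_hilbert (E : hilbertModType A) : hilbert E.
Proof.
split; [move=> x|exact: ip_def|exact: hnorm_complete].
by have [b ->] := ip_pos x; exact: cpos_sqr.
Qed.

Section FormModule.
Variable F : formModType A.
Implicit Types x y z w : F.

Lemma ipDl x y z : ip (x + y) z = ip x z + ip y z :> A.
Proof. by rewrite -ipC ipDr cstarD !ipC. Qed.
Lemma ipZl (l : R[i]) x y : ip (l *: x) y = conjc l *: ip x y :> A.
Proof. by rewrite -ipC ipZr cstarZ !ipC. Qed.
Lemma ipNr x y : ip x (- y) = - ip x y :> A.
Proof. by rewrite -scaleN1r ipZr scaleN1r. Qed.
Lemma ipNl x y : ip (- x) y = - ip x y :> A.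
Proof. by rewrite -ipC ipNr cstarN ipC. Qed.
Lemma ipBr x y z : ip x (y - z) = ip x y - ip x z :> A.
Proof. by rewrite ipDr ipNr. Qed.
Lemma ipBl x y z : ip (x - y) z = ip x z - ip y z :> A.
Proof. by rewrite ipDl ipNl. Qed.
Lemma ip0r x : ip x 0 = 0 :> A.
Proof. by have := ipZr 0 x 0; rewrite !scale0r. Qed.
Lemma ip0l x : ip 0 x = 0 :> A.
Proof. by rewrite -ipC ip0r cstar0. Qed.
Lemma ipMl x y a : ip (ract x a) y = cmul (cstar a) (ip x y) :> A.
Proof. by rewrite -ipC ipMr cstarM ipC. Qed.
Lemma ractNl x a : ract (- x) a = - ract x a.
Proof. by rewrite -scaleN1r ractZl scaleN1r. Qed.

Lemma hnorm_ge0 x : 0 <= hnorm x.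
Proof. exact: sqrtr_ge0. Qed.

Lemma hnorm_sqr x : hnorm x ^+ 2 = rnorm (ip x x : A).
Proof. by rewrite sqr_sqrtr // rnorm_ge0. Qed.

Lemma hnormE x : hnorm x = Num.sqrt (rnorm (ip x x : A)).
Proof. by []. Qed.

Lemma hnorm0 : hnorm (0 : F) = 0.
Proof. by rewrite hnormE ip0r rnorm0 sqrtr0. Qed.

Lemma hnormN x : hnorm (- x) = hnorm x.
Proof. by rewrite !hnormE ipNr ipNl opprK. Qed.

Lemma hnormBC x y : hnorm (x - y) = hnorm (y - x).
Proof. by rewrite -hnormN opprB. Qed.

Lemma hnormMr (t : R) x : hnorm (t%:C *: x) = `|t| * hnorm x.
Proof.
rewrite !hnormE ipZr ipZl conjc_real scalerA -rmorphM rnormMr sqrtrM.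
  by rewrite -expr2 normrX sqrtr_sqr normr_id.
exact: normr_ge0.
Qed.

Lemma hnormMi x : hnorm ('i%C *: x) = hnorm x.
Proof.
rewrite !hnormE ipZr ipZl scalerA.
have -> : 'i%C * conjc 'i%C = 1 :> R[i] by simpc.
by rewrite scale1r.
Qed.

End FormModule.

Section HilbertTheory.
Variables (F : formModType A) (hF : hilbert F).
Implicit Types x y z w : F.

Lemma hnorm0_eq0 x : hnorm x = 0 -> x = 0.
Proof.
by move=> h; apply: (hilbert_def hF); apply: rnorm0_eq0; rewrite -hnorm_sqr h expr0n.
Qed.

(* With n = |<x, x>| and a = <x, y>, n^2 <y, y> - n a* a is the sum of
   <z, z>, for z = x a - n y, and of the positive n a* a - a* <x, x> a. *)
Lemma cauchy_schwarz x y : rnorm (ip x y : A) <= hnorm x * hnorm y.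
Proof.
have [x0|x0] := eqVneq (hnorm x) 0.
  by rewrite (hnorm0_eq0 x0) ip0l rnorm0 hnorm0 mul0r.
pose n := rnorm (ip x x : A); pose a : A := ip x y.
have n0 : 0 < n by rewrite /n -hnorm_sqr exprn_gt0 // lt_neqAle eq_sym x0 hnorm_ge0.
pose z := ract x a - n%:C *: y.
pose p : A := n%:C *: cmul (cstar a) a - cmul (cstar a) (cmul (ip x x) a).
have e : n%:C *: cmul (cstar a) a + (ip z z + p) = (n ^+ 2)%:C *: ip y y :> A.
  have zz : ip z z = cmul (cstar a) (cmul (ip x x) a) -
      n%:C *: cmul (cstar a) a - (n%:C *: cmul (cstar a) a - (n ^+ 2)%:C *: ip y y) :> A.
    rewrite /z ipBl !ipBr !ipZl !ipZr !ipMr !ipMl conjc_real -cmulA.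
    by rewrite -(ipC x y) scalerA -rmorphM -expr2.
  rewrite zz /p opprB; set U := _ *: cmul _ a; set C := cmul _ (cmul _ a).
  by rewrite [C - U + _ + _]addrAC [C - U + (U - C)]addrA subrK subrr add0r addrC subrK.
have h : rnorm (n%:C *: cmul (cstar a) a) <= rnorm ((n ^+ 2)%:C *: (ip y y : A)).
  rewrite -e; apply: rnorm_cpos_le.
    by apply: cposZ (ltW n0) _; exact: cpos_sqr.
  by apply: cposD; [exact: hilbert_pos|exact: cpos_conj (hilbert_pos hF x)].
rewrite !rnormMr rnorm_csqr -hnorm_sqr !ger0_norm ?(ltW n0) ?sqr_ge0 // in h.
rewrite -ler_sqr ?nnegrE ?mulr_ge0 ?rnorm_ge0 ?hnorm_ge0 //.
rewrite exprMn hnorm_sqr -/n -/a -(ler_pM2l n0).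
by rewrite (_ : n * (n * _) = n ^+ 2 * hnorm y ^+ 2) //; ring.
Qed.

Lemma hnorm_add x y : hnorm (x + y) <= hnorm x + hnorm y.
Proof.
rewrite -ler_sqr ?nnegrE ?addr_ge0 ?hnorm_ge0 // hnorm_sqr ipDl !ipDr.
have h1 := rnormD (ip x x + ip x y) (ip y x + ip y y : A).
have h2 := rnormD (ip x x) (ip x y : A); have h3 := rnormD (ip y x) (ip y y : A).
have h4 := cauchy_schwarz x y; have h5 := cauchy_schwarz y x.
have h6 := hnorm_sqr x; have h7 := hnorm_sqr y.
lra.
Qed.

Lemma hnorm_sub x y : hnorm (x - y) <= hnorm x + hnorm y.
Proof. by rewrite -(hnormN y) hnorm_add. Qed.

Lemma hnorm_le_sum x w (p : A) : cpos p -> ip w w = ip x x + p ->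
  hnorm x <= hnorm w.
Proof.
move=> pp e; rewrite -ler_sqr ?nnegrE ?hnorm_ge0 // !hnorm_sqr e.
by apply: rnorm_cpos_le => //; exact: hilbert_pos.
Qed.

End HilbertTheory.

Section Sum.
Variables (E F : formModType A) (hE : hilbert E) (hF : hilbert F).

Lemma ip_pair (x y : (E * F)%type) : ip x y = ip x.1 y.1 + ip x.2 y.2 :> A.
Proof. by []. Qed.

Lemma hnorm_pair_le (x : (E * F)%type) : hnorm x <= hnorm x.1 + hnorm x.2.
Proof.
rewrite -ler_sqr ?nnegrE ?addr_ge0 ?hnorm_ge0 // hnorm_sqr ip_pair.
apply: le_trans (rnormD _ _) _; rewrite -!hnorm_sqr.
have := hnorm_ge0 x.1; have := hnorm_ge0 x.2; nra.
Qed.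

Lemma hnorm_fst_le (x : (E * F)%type) : hnorm x.1 <= hnorm x.
Proof.
rewrite -ler_sqr ?nnegrE ?hnorm_ge0 // !hnorm_sqr ip_pair.
by apply: rnorm_cpos_le; exact: hilbert_pos.
Qed.

Lemma hnorm_snd_le (x : (E * F)%type) : hnorm x.2 <= hnorm x.
Proof.
rewrite -ler_sqr ?nnegrE ?hnorm_ge0 // !hnorm_sqr ip_pair addrC.
by apply: rnorm_cpos_le; exact: hilbert_pos.
Qed.

Lemma hilbert_pair : hilbert (E * F)%type.
Proof.
have pos (x : (E * F)%type) : cpos (ip x x : A).
  by rewrite ip_pair; apply: cposD; exact: hilbert_pos.
split=> // [x x0|u uC].
  have n0 : hnorm x = 0 by rewrite hnormE x0 rnorm0 sqrtr0.
  have x1 := hnorm_fst_le x; have x2 := hnorm_snd_le x; rewrite n0 in x1 x2.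
  case: x x1 x2 {x0 n0} => a b /= x1 x2; congr pair.
    by apply: (hnorm0_eq0 hE); apply/eqP; rewrite eq_le x1 hnorm_ge0.
  by apply: (hnorm0_eq0 hF); apply/eqP; rewrite eq_le x2 hnorm_ge0.
have [e e0|l1 hl1] := hilbert_complete hE (u := fun n => (u n).1).
  have [N hN] := uC e e0; exists N => m n Nm Nn.
  by apply: le_lt_trans (hN m n Nm Nn); exact: (hnorm_fst_le (u m - u n)).
have [e e0|l2 hl2] := hilbert_complete hF (u := fun n => (u n).2).
  have [N hN] := uC e e0; exists N => m n Nm Nn.
  by apply: le_lt_trans (hN m n Nm Nn); exact: (hnorm_snd_le (u m - u n)).
exists (l1, l2) => e e0; have e2 : 0 < e / 2 by rewrite divr_gt0.
have [N1 h1] := hl1 _ e2; have [N2 h2] := hl2 _ e2.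
exists (maxn N1 N2) => n; rewrite geq_max => /andP[n1 n2].
apply: le_lt_trans (hnorm_pair_le _) _ => /=.
have := h1 n n1; have := h2 n n2; lra.
Qed.

End Sum.

End Hilbert.

(** * Symmetric operators and their resolvents *)

Section ImaginaryScalars.
Variable R : realType.

Definition im (t : R) : R[i] := 'i%C * t%:C.

Lemma imD s t : im (s + t) = im s + im t.
Proof. by rewrite /im rmorphD mulrDr. Qed.
Lemma imN t : im (- t) = - im t.
Proof. by rewrite /im rmorphN mulrN. Qed.
Lemma imB s t : im (s - t) = im s - im t.
Proof. by rewrite imD imN. Qed.
Lemma imM s t : im s * im t = - (s * t)%:C.
Proof. by rewrite /im mulrACA -expr2 sqr_i -rmorphM mulN1r. Qed.
Lemma imMr s t : s%:C * im t = im (s * t).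
Proof. by rewrite /im mulrCA -rmorphM. Qed.
Lemma conjc_im t : conjc (im t) = - im t.
Proof. by rewrite /im; simpc. Qed.
Lemma hnorm_im (A : cstarAlgType R) (F : formModType A) t (x : F) :
  hnorm (im t *: x) = `|t| * hnorm x.
Proof. by rewrite -scalerA hnormMi hnormMr. Qed.

End ImaginaryScalars.

Section Operators.
Variables (R : realType) (A : cstarAlgType R) (F : formModType A).
Hypothesis hF : hilbert F.
Implicit Types (S T : oper F F) (x y z : F) (f Q : F -> F).

Lemma hnorm_le0 x : hnorm x <= 0 -> x = 0.
Proof. by move=> h; apply/(hnorm0_eq0 hF)/eqP; rewrite eq_le h hnorm_ge0. Qed.

Lemma additive_0 f : {morph f : x y / x + y} -> f 0 = 0.
Proof.
by move=> fD; have /(congr1 (fun z => z - f 0)) := fD 0 0; rewrite addr0 subrr addrK.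
Qed.

Lemma additive_N f : {morph f : x y / x + y} -> {morph f : x / - x}.
Proof.
move=> fD x; apply/eqP; rewrite -addr_eq0 -fD addNr; exact/eqP/additive_0.
Qed.

Lemma additive_B f : {morph f : x y / x + y} -> {morph f : x y / x - y}.
Proof. by move=> fD x y; rewrite fD additive_N. Qed.

Lemma expr_small (t d : R) : 0 <= t < 1 -> 0 < d -> exists n, t ^+ n < d.
Proof.
move=> /andP[t0 t1] d0.
have : (fun n => t ^+ n) @ \oo --> (0 : R) by apply: cvg_expr; rewrite ger0_norm.
move=> /cvgrPdist_lt/(_ d d0)[N _ /(_ N (leqnn N))] /= h.
by exists N; move: h; rewrite sub0r normrN ger0_norm // exprn_ge0.
Qed.

Lemma neumann f (t : R) : {morph f : x y / x + y} -> 0 <= t < 1 ->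
  (forall x, hnorm (f x) <= t * hnorm x) -> forall y, exists x, x + f x = y.
Proof.
move=> fD t01 fn y; have [t0 t1] := andP t01.
pose u := fix u n := if n is n'.+1 then y - f (u n') else 0.
(* K solves |y| + t K = K, so it bounds every iterate, and hence the initial error, as u 0 = 0. *)
pose K := hnorm y / (1 - t).
have K0 : 0 <= K by rewrite divr_ge0 ?hnorm_ge0 // subr_ge0 ltW.
have eK : hnorm y + t * K = K.
  by rewrite /K; field; rewrite subr_eq0 eq_sym lt_eqF.
have bnd_u m : hnorm (u m) <= K.
  elim: m => [|m IH]; first by rewrite hnorm0.
  rewrite /=; apply: le_trans (hnorm_sub hF _ _) _; rewrite -[leRHS]eK lerD2l.
  by apply: le_trans (fn _) _; rewrite ler_wpM2l.
have uC n m : (n <= m)%N -> hnorm (u m - u n) <= K * t ^+ n.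
  elim: n m => [|n IH] [|m] //; rewrite ?subr0 ?expr0 ?mulr1 //.
  rewrite ltnS => /IH h /=.
  rewrite opprB addrC addrA subrK -additive_B //.
  apply: le_trans (fn _) _; rewrite hnormBC exprS mulrCA ler_wpM2l //.
have [e e0|l hl] := hilbert_complete hF (u := u).
  have [N hN] : exists n, t ^+ n < e / (2 * (K + 1)).
    by apply: expr_small => //; rewrite divr_gt0 // mulr_gt0 // ltr_wpDl.
  exists N => m n Nm Nn; rewrite ltr_pdivlMr ?mulr_gt0 ?ltr_wpDl // in hN.
  have hm := uC N m Nm; have hn := uC N n Nn.
  have := hnorm_sub hF (u m - u N) (u n - u N); rewrite opprB addrA subrK.
  have := exprn_ge0 N t0; nra.
exists l; apply/eqP; rewrite -subr_eq0; apply/eqP/hnorm_le0/ler_addgt0Pr => e e0.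
have [N hN] := hl (e / 2) (divr_gt0 e0 (ltr0Sn _ 1)).
rewrite add0r.
have h1 := hN N (leqnn N); have h2 := hN N.+1 (leqnSn N).
have -> : l + f l - y = f (l - u N) - (u N.+1 - l).
  by rewrite additive_B //= !opprB [RHS]addrCA [_ - f (u N) + _]addrA subrK addrA.
have h3 := fn (l - u N); rewrite [hnorm (l - _)]hnormBC in h3.
have := hnorm_sub hF (f (l - u N)) (u N.+1 - l).
have := hnorm_ge0 (u N - l); nra.
Qed.

Record symmetric_oper S : Prop := SymmetricOper {
  sym_domD : forall x y, odom S x -> odom S y -> odom S (x + y);
  sym_domZ : forall (l : R[i]) x, odom S x -> odom S (l *: x);
  symD : forall x y, odom S x -> odom S y -> S (x + y) = S x + S y;
  symZ : forall (l : R[i]) x, odom S x -> S (l *: x) = l *: S x;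
  sym_ip : forall x y, odom S x -> odom S y -> ip (S x) y = ip x (S y) :> A }.

Section Symmetric.
Variables (S : oper F F) (symS : symmetric_oper S).

Lemma sym_domN x : odom S x -> odom S (- x).
Proof. by rewrite -scaleN1r; exact: (sym_domZ symS). Qed.
Lemma sym_domB x y : odom S x -> odom S y -> odom S (x - y).
Proof. by move=> hx hy; apply: sym_domD (sym_domN _). Qed.
Lemma symN x : odom S x -> S (- x) = - S x.
Proof. by move=> hx; rewrite -scaleN1r (symZ symS) // scaleN1r. Qed.
Lemma symB x y : odom S x -> odom S y -> S (x - y) = S x - S y.
Proof. by move=> hx hy; rewrite (symD symS) ?symN //; exact: sym_domN. Qed.

(** The cross terms cancel by symmetry. Both summands on the right are positive, so each is
    dominated in norm by their sum. *)
Lemma ip_shift (mu : R) x : odom S x ->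
  ip (S x - im mu *: x) (S x - im mu *: x) =
  ip (S x) (S x) + (mu ^+ 2)%:C *: ip x x :> A.
Proof.
move=> hx; rewrite ipBl !ipBr !ipZl !ipZr conjc_im (sym_ip symS hx hx).
rewrite !scaleNr opprK scalerA imM scaleNr opprD !opprK addrA subrK.
by rewrite -expr2.
Qed.

Lemma hnorm_shift_ge (mu : R) x : odom S x ->
  hnorm (S x) <= hnorm (S x - im mu *: x).
Proof.
move=> hx; apply: (hnorm_le_sum hF _ (ip_shift mu hx)).
by apply: cposZ (sqr_ge0 mu) _; exact: hilbert_pos.
Qed.

Lemma hnorm_shift_geZ (mu : R) x : odom S x ->
  `|mu| * hnorm x <= hnorm (S x - im mu *: x).
Proof.
move=> hx; rewrite -hnormMr.
apply: (hnorm_le_sum hF (hilbert_pos hF (S x))).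
by rewrite ip_shift // ipZl ipZr conjc_real scalerA -rmorphM -expr2 addrC.
Qed.

(** A total function that is only required to be a right inverse; for mu != 0 the lower bound on S -
    i mu makes it two-sided. *)
Definition resolvent_of (mu : R) Q :=
  forall y, odom S (Q y) /\ S (Q y) - im mu *: Q y = y.

Definition onto (mu : R) :=
  forall y, exists x, odom S x /\ S x - im mu *: x = y.

Lemma onto_resolvent mu : onto mu -> exists Q, resolvent_of mu Q.
Proof. by move=> /choice[Q hQ]; exists Q. Qed.

Section Resolvent.
Variables (mu : R) (mu0 : mu != 0) (Q : F -> F) (hQ : resolvent_of mu Q).

Lemma res_dom y : odom S (Q y). Proof. by have [] := hQ y. Qed.

Lemma resE y : S (Q y) = y + im mu *: Q y.
Proof. by have [_ {2}<-] := hQ y; rewrite subrK. Qed.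

Lemma res_unique x y : odom S x -> S x - im mu *: x = y -> Q y = x.
Proof.
move=> hx hy; apply/eqP; rewrite -subr_eq0; apply/eqP/hnorm_le0.
have [h1 h2] := hQ y.
have h := hnorm_shift_geZ mu (sym_domB h1 hx).
move: h; rewrite symB // scalerBr opprB; set t := hnorm (_ - _) => h.
have h0 : hnorm (S (Q y) - S x + (im mu *: x - im mu *: Q y)) = 0.
  rewrite [im mu *: x - _]addrC addrACA h2 [- S x + _]addrC -opprB hy.
  by rewrite subrr hnorm0.
by move: h; rewrite h0 pmulr_rle0 // normr_gt0.
Qed.

Lemma resK x : odom S x -> Q (S x - im mu *: x) = x.
Proof. by move=> hx; exact: res_unique. Qed.

Lemma resD : {morph Q : x y / x + y}.
Proof.
move=> x y; apply: res_unique; first by apply: (sym_domD symS); exact: res_dom.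
rewrite (symD symS); [|exact: res_dom..].
by rewrite !resE scalerDr addrACA addrK.
Qed.

Lemma resZ (l : R[i]) x : Q (l *: x) = l *: Q x.
Proof.
apply: res_unique; first by apply: (sym_domZ symS); exact: res_dom.
rewrite (symZ symS); last exact: res_dom.
by rewrite resE scalerDr !scalerA mulrC addrK.
Qed.

Lemma hnorm_res y : `|mu| * hnorm (Q y) <= hnorm y.
Proof. by have [h1 {2}<-] := hQ y; exact: hnorm_shift_geZ. Qed.

Lemma hnorm_res_le y : hnorm (Q y) <= `|mu|^-1 * hnorm y.
Proof. by rewrite ler_pdivlMl ?normr_gt0 // hnorm_res. Qed.

Lemma res_op x : odom S x -> Q (S x) = S (Q x).
Proof.
move=> hx; rewrite -{1}[S x](subrK (im mu *: x)) resD resZ resK //.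
by rewrite resE.
Qed.

Lemma sym_onto_closed a b :
  (forall e, 0 < e -> exists x, [/\ odom S x, hnorm (x - a) < e & hnorm (S x - b) < e]) ->
  odom S a /\ S a = b.
Proof.
move=> h; suff e : a = Q (b - im mu *: a).
  by rewrite e; split; [exact: res_dom|rewrite resE -e subrK].
apply/eqP; rewrite -subr_eq0; apply/eqP/hnorm_le0/ler_addgt0Pr => e e0.
rewrite add0r.
have m0 : 0 < `|mu| by rewrite normr_gt0.
(* |mu| |a - Q (b - i mu a)| <= 2 |mu| |x - a| + |S x - b|, which explains 2 |mu| + 1. *)
have [|x [hx hxa hxb]] := h (e * `|mu| / (2 * `|mu| + 1)).
  by rewrite divr_gt0 ?mulr_gt0 // ltr_wpDl // mulr_ge0.
have d0 : 0 < 2 * `|mu| + 1 by rewrite ltr_wpDl // mulr_ge0.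
rewrite ltr_pdivlMr // in hxa; rewrite ltr_pdivlMr // in hxb.
have h1 := hnorm_res (S x - im mu *: x - (b - im mu *: a)).
rewrite (additive_B resD) resK // in h1.
have h2 : hnorm (S x - im mu *: x - (b - im mu *: a)) <=
    hnorm (S x - b) + `|mu| * hnorm (x - a).
  rewrite -hnorm_im scalerBr -(hnormN (im mu *: x - _)).
  by apply: le_trans (hnorm_add hF _ _); rewrite !opprD !opprK addrACA.
have h3 := hnorm_add hF (a - x) (x - Q (b - im mu *: a)).
rewrite addrA subrK (hnormBC a x) in h3.
have h4 : (2 * `|mu| + 1) * (2 * `|mu| * hnorm (x - a) + hnorm (S x - b)) <=
    (2 * `|mu| + 1) * (`|mu| * e) by nra.
have h5 := ler_wpM2l (ltW m0) h3; rewrite mulrDr in h5.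
rewrite ler_pM2l // in h4; rewrite -(ler_pM2l m0); lra.
Qed.

End Resolvent.

(** S - i nu = (1 + i (mu - nu) Q) (S - i mu) with |Q| <= 1 / |mu|: a Neumann series. *)
Lemma onto_shift mu nu : mu != 0 -> `|nu - mu| < `|mu| -> onto mu -> onto nu.
Proof.
move=> mu0 hnu /onto_resolvent[Q hQ] y.
have m0 : 0 < `|mu| by rewrite normr_gt0.
have [||x|u hu] := @neumann (fun x => im (mu - nu) *: Q x) (`|nu - mu| / `|mu|) _ _ _ y.
- by move=> x z; rewrite (resD mu0 hQ) scalerDr.
- by rewrite divr_ge0 ?normr_ge0 // ltr_pdivrMr // mul1r.
- by rewrite hnorm_im distrC -mulrA ler_wpM2l // (hnorm_res_le mu0 hQ).
exists (Q u); split; first exact: res_dom hQ _.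
by rewrite (resE hQ) -addrA -scalerBl -imB.
Qed.

(** A shift reaches any parameter at distance less than |mu|. Growing by the factor 3 / 2 until t is
    passed, a single downward shift then lands on t mu. *)
Lemma onto_pos mu (t : R) : mu != 0 -> 0 < t -> onto mu -> onto (t * mu).
Proof.
move=> mu0 t0 hmu.
have m0 : 0 < `|mu| by rewrite normr_gt0.
have pow n : onto ((3 / 2) ^+ n * mu).
  elim: n => [|n IH]; first by rewrite mul1r.
  have p0 : 0 < (3 / 2) ^+ n :> R by rewrite exprn_gt0.
  apply: onto_shift IH; first by rewrite mulf_neq0 // gt_eqF.
  rewrite -mulrBl exprS (_ : 3 / 2 * _ - _ = (3 / 2) ^+ n / 2); last by field.
  by rewrite ![`|_ * mu|]normrM ltr_pM2r // !gtr0_norm ?divr_gt0 //; lra.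
have [n hn] : exists n, (2 / 3) ^+ n < t^-1 :> R.
  by apply: expr_small; [apply/andP; split; lra|rewrite invr_gt0].
have p0 : 0 < (3 / 2) ^+ n :> R by rewrite exprn_gt0.
have tn : t < (3 / 2) ^+ n.
  have e : (2 / 3) ^+ n = ((3 / 2) ^+ n)^-1 :> R by rewrite -exprVn invf_div.
  by rewrite e ltf_pV2 in hn.
apply: onto_shift (pow n); first by rewrite mulf_neq0 // gt_eqF.
by rewrite -mulrBl !normrM ltr_pM2r // (gtr0_norm p0) ltr_norml; apply/andP; split; lra.
Qed.

End Symmetric.

(** * Convergence, closed operators and dense ranges *)

Definition hcvg (u : nat -> F) l := forall e : R, 0 < e ->
  exists N : nat, forall n, (N <= n)%N -> hnorm (u n - l) < e.

Definition closed_oper S := forall u a b, (forall n, odom S (u n)) ->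
  hcvg u a -> hcvg (fun n => S (u n)) b -> odom S a /\ S a = b.

Lemma hcvg_unique u a b : hcvg u a -> hcvg u b -> a = b.
Proof.
move=> ha hb; apply/eqP; rewrite -subr_eq0; apply/eqP/hnorm_le0/ler_addgt0Pr => e e0.
have e2 : 0 < e / 2 by rewrite divr_gt0.
have [N hN] := ha _ e2; have [M hM] := hb _ e2.
have h1 := hN (maxn N M) (leq_maxl _ _); have h2 := hM (maxn N M) (leq_maxr _ _).
have := hnorm_sub hF (u (maxn N M) - b) (u (maxn N M) - a).
rewrite opprB addrC addrA subrK; lra.
Qed.

Lemma hcvgD u v a b : hcvg u a -> hcvg v b -> hcvg (fun n => u n + v n) (a + b).
Proof.
move=> ha hb e e0; have e2 : 0 < e / 2 by rewrite divr_gt0.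
have [N hN] := ha _ e2; have [M hM] := hb _ e2.
exists (maxn N M) => n; rewrite geq_max => /andP[/hN h1 /hM h2].
have := hnorm_add hF (u n - a) (v n - b); rewrite addrACA -opprD; lra.
Qed.

Lemma hcvg_additive f (C : R) u a : {morph f : x y / x + y} ->
  (forall x, hnorm (f x) <= C * hnorm x) -> hcvg u a -> hcvg (fun n => f (u n)) (f a).
Proof.
move=> fD fC ha e e0; have C1 : 0 < `|C| + 1 by rewrite ltr_wpDl.
have [N hN] := ha _ (divr_gt0 e0 C1); exists N => n /hN.
rewrite ltr_pdivlMr // -additive_B // => h.
have := fC (u n - a); have := ler_norm C; have := hnorm_ge0 (u n - a); nra.
Qed.

Lemma hcvg_cauchy (f w : nat -> F) y (C : R) :
  (forall m n, hnorm (f m - f n) <= C * hnorm (w m - w n)) -> hcvg w y ->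
  exists l, hcvg f l.
Proof.
move=> fC wy; apply: (hilbert_complete hF) => e e0.
have C1 : 0 < 2 * (`|C| + 1) by rewrite mulr_gt0 // ltr_wpDl.
have [N hN] := wy _ (divr_gt0 e0 C1); exists N => m n /hN hm /hN hn.
rewrite !ltr_pdivlMr // in hm hn.
have := hnorm_sub hF (w m - y) (w n - y); rewrite opprB addrA subrK.
have := fC m n; have := ler_norm C; have := hnorm_ge0 (w m - w n); nra.
Qed.

Lemma sym_onto_closed_oper S mu : symmetric_oper S -> mu != 0 -> onto S mu ->
  closed_oper S.
Proof.
move=> symS mu0 /onto_resolvent[Q hQ] u a b du ua ub.
apply: (sym_onto_closed symS mu0 hQ) => e e0.
have [N hN] := ua _ e0; have [M hM] := ub _ e0.
exists (u (maxn N M)); split=> //; [exact/hN/leq_maxl|exact/hM/leq_maxr].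
Qed.

(** If the images under S - i mu converge, its lower bounds make both u n and S (u n) Cauchy, and
    closedness identifies the limits. *)
Lemma dense_range_onto S mu : symmetric_oper S -> mu != 0 -> closed_oper S ->
  (forall y e, 0 < e -> exists x, odom S x /\ hnorm (S x - im mu *: x - y) < e) ->
  onto S mu.
Proof.
move=> symS mu0 clS dr y; have m0 : 0 < `|mu| by rewrite normr_gt0.
have [n|u hu] := @choice _ _ (fun n x => odom S x /\
    hnorm (S x - im mu *: x - y) < n.+1%:R^-1).
  by apply: dr; rewrite invr_gt0.
have du n : odom S (u n) by have [] := hu n.
pose w n := S (u n) - im mu *: u n.
have wy : hcvg w y.
  move=> e e0; exists (Num.truncn e^-1) => n hn.
  have [_ /lt_le_trans] := hu n; apply.
  rewrite -[leRHS]invrK lef_pV2 ?posrE ?invr_gt0 //.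
  apply/ltW/(lt_le_trans (truncnS_gt _)); by rewrite ler_nat.
have wB m n : w m - w n = S (u m - u n) - im mu *: (u m - u n).
  by rewrite /w (symB symS) // scalerBr !opprD !opprK addrACA.
have dB m n : odom S (u m - u n) by exact: sym_domB.
have [|a ua] := @hcvg_cauchy u w y `|mu|^-1 _ wy.
  by move=> m n; rewrite wB ler_pdivlMl // hnorm_shift_geZ.
have [|b ub] := @hcvg_cauchy (fun n => S (u n)) w y 1 _ wy.
  by move=> m n; rewrite wB mul1r -(symB symS) // hnorm_shift_ge.
have [da Sa] := clS u a b du ua ub.
exists a; split=> //; apply: hcvg_unique wy; rewrite Sa.
have f_lin : {morph (fun x => - (im mu *: x)) : x y / x + y}.
  by move=> x z; rewrite scalerDr opprD.
apply: hcvgD ub (hcvg_additive f_lin (C := `|mu|) _ ua) => x.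
by rewrite hnormN hnorm_im.
Qed.

(** S + f - i mu = (1 + f Q) (S - i mu), with |f Q| <= b / |mu| < 1. *)
Lemma onto_perturb S (f : F -> F) (b mu : R) : symmetric_oper S ->
  {morph f : x y / x + y} -> 0 <= b -> (forall x, hnorm (f x) <= b * hnorm x) ->
  b < `|mu| -> onto S mu -> onto (Oper (odom S) (fun x => S x + f x)) mu.
Proof.
move=> symS fD b0 fb bmu /onto_resolvent[Q hQ] y.
have m0 : 0 < `|mu| by apply: le_lt_trans bmu.
have mu0 : mu != 0 by rewrite -normr_gt0.
have [||x|u hu] := @neumann (fun x => f (Q x)) (b / `|mu|) _ _ _ y.
- by move=> x z; rewrite (resD symS mu0 hQ) fD.
- by rewrite divr_ge0 ?normr_ge0 // ltr_pdivrMr // mul1r.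
- by apply: le_trans (fb _) _; rewrite -mulrA ler_wpM2l // (hnorm_res_le symS).
exists (Q u); split; first exact: res_dom hQ _.
by rewrite /= (resE hQ) addrAC addrK.
Qed.

End Operators.

(** * Sums of anticommuting operators *)

Section AnticommutingSum.
Variables (R : realType) (A : cstarAlgType R) (F : formModType A).
Hypothesis hF : hilbert F.
Variables (S T : oper F F) (symS : symmetric_oper S) (symT : symmetric_oper T).
Hypothesis ontoS : forall mu, mu != 0 -> onto S mu.
Hypothesis ontoT : forall mu, mu != 0 -> onto T mu.
Variable J : F -> F.
Hypothesis JD : {morph J : x y / x + y}.
Hypothesis JZ : forall (l : R[i]) x, J (l *: x) = l *: J x.
Hypothesis JK : involutive J.
Hypothesis ip_J : forall x y, ip (J x) y = ip x (J y) :> A.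
Hypothesis domSJ : forall x, odom S x -> odom S (J x).
Hypothesis domTJ : forall x, odom T x -> odom T (J x).
Hypothesis SJ : forall x, odom S x -> S (J x) = J (S x).
Hypothesis TJ : forall x, odom T x -> T (J x) = - J (T x).
(* [TR1] below states that Y = [S, T] R1 on dom T without requiring T R1 to take
   values in dom S. *)
Variables (Y R1 : F -> F) (c : R).
Hypothesis YD : {morph Y : x y / x + y}.
Hypothesis c0 : 0 <= c.
Hypothesis Y_bnd : forall x, hnorm (Y x) <= c * hnorm x.
Hypothesis R1_res : resolvent_of S 1 R1.
Hypothesis domTR : forall x, odom T x -> odom T (R1 x).
Hypothesis TR1 : forall x, odom T x -> T (R1 x) = R1 (T x) + R1 (Y x).
Hypothesis denseT : hdense (odom T).
Implicit Types x y z u v : F.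

Definition sum_oper : oper F F :=
  Oper (odom S `&` odom T) (fun x => S (J x) + T x).

Let JN := additive_N JD.
Let JB := additive_B JD.

Lemma hnorm_J x : hnorm (J x) = hnorm x.
Proof. by rewrite !hnormE ip_J JK. Qed.

Let shiftS x := S x - im 1 *: x.

(* The solution v of v + Q Y v = Q u satisfies R1 v = Q x whenever x = R1 u. *)
Lemma resolvent_commutator mu Q x : mu != 0 -> 2 * c <= `|mu| ->
  resolvent_of T mu Q -> odom S x ->
  odom S (Q x) /\
  hnorm (S (Q x) - Q (S x)) <= 2 * c / mu ^+ 2 * hnorm (shiftS x).
Proof.
move=> mu0 hmu hQ hx; have m0 : 0 < `|mu| by rewrite normr_gt0.
pose u := shiftS x.
have QD := resD hF symT mu0 hQ.
have Qn := hnorm_res hF symT hQ.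
have QY z : hnorm (Q (Y z)) <= 2^-1 * hnorm z.
  rewrite -(ler_pM2l m0); apply: le_trans (Qn _) _.
  apply: le_trans (Y_bnd _) _; rewrite mulrA ler_wpM2r ?hnorm_ge0 //.
  by rewrite ler_pdivlMr // mulrC.
have [||v hv] := @neumann _ _ _ hF (fun z => Q (Y z)) 2^-1 _ _ QY (Q u).
- by move=> z z'; rewrite YD QD.
- by apply/andP; split; lra.
have vE : v = Q (u - Y v) by rewrite (additive_B QD) -hv addrK.
have dv : odom T v by rewrite vE; exact: res_dom hQ _.
have vT : T v - im mu *: v = u - Y v by rewrite {1 2}vE; have [] := hQ (u - Y v).
have one0 : (1 : R) != 0 := oner_neq0 R.
have R1D := resD hF symS one0 R1_res.
have R1Z := resZ hF symS one0 R1_res.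
(* (T - i mu) R1 v = R1 ((T - i mu) v + Y v) = R1 u = x. *)
have RvQ : Q x = R1 v.
  apply: (res_unique hF symT mu0 hQ); first exact: domTR.
  rewrite TR1 // -R1Z addrAC -(additive_B R1D) vT -R1D subrK.
  exact: (resK hF symS one0 R1_res).
rewrite RvQ; split; first exact: res_dom R1_res _.
(* Writing S = (S - i) + i, the terms i Q x cancel and v - Q u = - Q Y v remains. *)
have e : S (R1 v) - Q (S x) = - Q (Y v).
  rewrite (resE R1_res) -RvQ -{1}[S x](subrK (im 1 *: x)) QD (resZ hF symT mu0 hQ).
  by rewrite opprD addrACA subrr addr0 -/u -hv opprD addrA subrr add0r.
rewrite e hnormN.
have nv : `|mu| * hnorm v <= 2 * hnorm u.
  have h := hnorm_sub hF (Q u) (Q (Y v)); rewrite -hv addrK in h.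
  have h2 := QY v; rewrite hv in h; have h3 := Qn u; nra.
have h4 := Qn (Y v); have h5 := Y_bnd v.
rewrite -(ler_pM2l m0) -(ler_pM2l m0).
have -> : `|mu| * (`|mu| * (2 * c / mu ^+ 2 * hnorm (shiftS x))) = c * (2 * hnorm u).
  rewrite -/u -real_normK ?num_real //; field.
  exact: lt0r_neq0.
apply: (@le_trans _ _ (`|mu| * (c * hnorm v))).
  by rewrite ler_pM2l // (le_trans h4).
by rewrite mulrCA ler_wpM2l.
Qed.

Definition twist : oper F F := Oper (odom S) (fun x => S (J x)).

Lemma twist_sym : symmetric_oper twist.
Proof.
split => /=; [exact: sym_domD symS|exact: sym_domZ symS| | |].
- by move=> x y hx hy; rewrite JD (symD symS) //; exact: domSJ.
- by move=> l x hx; rewrite JZ (symZ symS) //; exact: domSJ.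
- move=> x y hx hy; rewrite (sym_ip symS) ?ip_J ?SJ //; exact: domSJ.
Qed.

(* J commutes with the resolvents of S and splits F into its eigenspaces for
   1 and -1, on which the twisted operator is S and - S. *)
Lemma twist_onto mu : mu != 0 -> onto twist mu.
Proof.
move=> mu0 y; have nmu0 : - mu != 0 by rewrite oppr_eq0.
have [Q hQ] := onto_resolvent (ontoS mu0).
have [Q' hQ'] := onto_resolvent (ontoS nmu0).
have JQ z : J (Q z) = Q (J z).
  have d := res_dom hQ z; apply/esym/(res_unique hF symS mu0 hQ); first exact: domSJ.
  by rewrite SJ // -JZ -JB (resE hQ) addrK.
have JQ' z : J (Q' z) = Q' (J z).
  have d := res_dom hQ' z; apply/esym/(res_unique hF symS nmu0 hQ'); first exact: domSJ.
  by rewrite SJ // -JZ -JB (resE hQ') addrK.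
pose p := (2^-1)%:C *: (y + J y); pose q := (2^-1)%:C *: (y - J y).
have Jp : J p = p by rewrite JZ JD JK addrC.
have Jq : J q = - q by rewrite JZ JB JK -scalerN opprB.
have pq : p + q = y.
  rewrite -scalerDr addrACA subrr addr0 scalerDr -scalerDl -rmorphD /=.
  have -> : 2^-1 + 2^-1 = 1 :> R by lra.
  by rewrite scale1r.
have dQ := res_dom hQ p; have dQ' := res_dom hQ' q.
exists (Q p - Q' q); split; first exact: (sym_domB symS).
rewrite /= JB JQ JQ' Jp Jq (additive_N (resD hF symS nmu0 hQ')) opprK.
rewrite (symD symS) // (resE hQ) (resE hQ') imN scaleNr scalerBr opprB.
by rewrite [p + _ + _]addrACA pq -addrA [_ - _ + (_ - _)]addrA subrK subrr addr0.
Qed.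

(** * The bounded approximations at a fixed parameter k *)

Section Cutoff.
Variables (k : R) (k0 : 0 < k) (hk : 2 * c <= k).
Variables (Qp Qm : F -> F).
Hypotheses (hp : resolvent_of T k Qp) (hm : resolvent_of T (- k) Qm).

Let kn0 : k != 0. Proof. by rewrite gt_eqF. Qed.
Let nkn0 : - k != 0. Proof. by rewrite oppr_eq0. Qed.

(* By partial fractions [cut] is k^2 (T^2 + k^2)^-1 and [yosida] is its product
   with T. *)
Definition cut x := im (k / 2) *: (Qm x - Qp x).
Definition yosida x := (k ^+ 2 / 2)%:C *: (Qp x + Qm x).

Let QpD := resD hF symT kn0 hp.
Let QmD := resD hF symT nkn0 hm.

Lemma cutD : {morph cut : x y / x + y}.
Proof. by move=> x y; rewrite /cut QpD QmD opprD addrACA scalerDr. Qed.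
Lemma cutZ (l : R[i]) x : cut (l *: x) = l *: cut x.
Proof.
rewrite /cut (resZ hF symT kn0 hp) (resZ hF symT nkn0 hm) -scalerBr.
by rewrite !scalerA mulrC.
Qed.
Lemma yosidaD : {morph yosida : x y / x + y}.
Proof. by move=> x y; rewrite /yosida QpD QmD addrACA scalerDr. Qed.
Lemma yosidaZ (l : R[i]) x : yosida (l *: x) = l *: yosida x.
Proof.
rewrite /yosida (resZ hF symT kn0 hp) (resZ hF symT nkn0 hm) -scalerDr.
by rewrite !scalerA mulrC.
Qed.

Lemma hnorm_Qp x : hnorm (Qp x) <= k^-1 * hnorm x.
Proof. by have := hnorm_res_le hF symT kn0 hp x; rewrite gtr0_norm. Qed.
Lemma hnorm_Qm x : hnorm (Qm x) <= k^-1 * hnorm x.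
Proof. by have := hnorm_res_le hF symT nkn0 hm x; rewrite normrN gtr0_norm. Qed.

Lemma hnorm_yosida x : hnorm (yosida x) <= k * hnorm x.
Proof.
rewrite hnormMr ger0_norm; last by rewrite divr_ge0 // sqr_ge0.
have -> : k * hnorm x = k ^+ 2 / 2 * (k^-1 * hnorm x + k^-1 * hnorm x) by field.
rewrite ler_pM2l ?divr_gt0 ?exprn_gt0 //.
by apply: le_trans (hnorm_add hF _ _) (lerD (hnorm_Qp _) (hnorm_Qm _)).
Qed.

Lemma hnorm_cut x : hnorm (cut x) <= hnorm x.
Proof.
rewrite hnorm_im gtr0_norm; last by rewrite divr_gt0.
have -> : hnorm x = k / 2 * (k^-1 * hnorm x + k^-1 * hnorm x) by field.
rewrite ler_pM2l ?divr_gt0 //.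
by apply: le_trans (hnorm_sub hF _ _) (lerD (hnorm_Qm _) (hnorm_Qp _)).
Qed.

Lemma cut_dom x : odom T (cut x).
Proof.
apply: (sym_domZ symT); apply: (sym_domB symT); [exact: res_dom hm _|exact: res_dom hp _].
Qed.

Lemma T_cut x : T (cut x) = yosida x.
Proof.
have d1 := res_dom hm x; have d2 := res_dom hp x.
rewrite (symZ symT) ?(symB symT) //; last exact: sym_domB.
rewrite (resE hm) (resE hp) opprD addrACA subrr add0r imN scaleNr -opprD -scalerDr.
by rewrite scalerN scalerA imM scaleNr opprK /yosida addrC mulrAC -expr2.
Qed.

Lemma cut_T x : odom T x -> cut (T x) = yosida x.
Proof.
move=> hx; have d1 := res_dom hm x; have d2 := res_dom hp x.
rewrite -T_cut [in RHS]/cut (symZ symT) ?(symB symT) //; last exact: sym_domB.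
by rewrite /cut (res_op hF symT nkn0 hm hx) (res_op hF symT kn0 hp hx).
Qed.

Lemma yosida_cut x : yosida (cut x) = cut (yosida x).
Proof. by rewrite -cut_T ?T_cut //; exact: cut_dom. Qed.

Lemma cut_close x : odom T x -> hnorm (x - cut x) <= k^-1 * hnorm (T x).
Proof.
move=> hx.
have -> : x - cut x = (2^-1)%:C *: (Qp (T x) + Qm (T x)).
  rewrite (res_op hF symT nkn0 hm hx) (res_op hF symT kn0 hp hx) (resE hm) (resE hp).
  rewrite addrACA imN scaleNr -scalerBr scalerDr scalerA imMr /cut.
  rewrite -scalerN opprB [_ *: (x + x)]scalerDr -scalerDl -rmorphD /=.
  have -> : 2^-1 + 2^-1 = 1 :> R by lra.
  by rewrite scale1r mulrC.
rewrite hnormMr ger0_norm //.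
have := hnorm_add hF (Qp (T x)) (Qm (T x)).
have := hnorm_Qp (T x); have := hnorm_Qm (T x); lra.
Qed.

(** J conjugates T into - T, hence (T - i k)^-1 into - (T + i k)^-1. So J commutes with [cut] and
    anticommutes with [yosida]. *)
Lemma J_Qp x : J (Qp x) = - Qm (J x).
Proof.
apply/eqP; rewrite -eqr_oppLR; apply/eqP/esym.
have d := res_dom hp x.
apply: (res_unique hF symT nkn0 hm); first by apply/(sym_domN symT)/domTJ.
rewrite (symN symT) ?TJ //; last exact: domTJ.
by rewrite opprK imN scaleNr scalerN opprK -JZ -JB (resE hp) addrK.
Qed.

Lemma J_Qm x : J (Qm x) = - Qp (J x).
Proof. by rewrite -[x in LHS]JK -[Qm _]opprK -J_Qp JN JK. Qed.

Lemma J_cut x : J (cut x) = cut (J x).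
Proof. by rewrite /cut JZ JB J_Qm J_Qp opprK addrC. Qed.

Lemma J_yosida x : J (yosida x) = - yosida (J x).
Proof. by rewrite /yosida JZ JD J_Qp J_Qm -opprD scalerN addrC. Qed.

Lemma ip_Qp x y : ip (Qp x) y = ip x (Qm y) :> A.
Proof.
have d1 := res_dom hp x; have d2 := res_dom hm y.
have [_ {2}<-] := hp x; have [_ {1}<-] := hm y.
rewrite ipBr ipBl ipZr ipZl conjc_im imN !scaleNr (sym_ip symT) //.
Qed.

Lemma ip_yosida x y : ip (yosida x) y = ip x (yosida y) :> A.
Proof.
have ip_Qm z z' : ip (Qm z) z' = ip z (Qp z') :> A by rewrite -ipC -ip_Qp ipC.
by rewrite /yosida ipZl ipZr conjc_real ipDl ipDr ip_Qp ip_Qm addrC.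
Qed.

Let comm_p x (hx : odom S x) :
  odom S (Qp x) /\ hnorm (S (Qp x) - Qp (S x)) <= 2 * c / k ^+ 2 * hnorm (shiftS x).
Proof. by apply: resolvent_commutator hp hx; rewrite // gtr0_norm. Qed.

Let comm_m x (hx : odom S x) :
  odom S (Qm x) /\ hnorm (S (Qm x) - Qm (S x)) <= 2 * c / k ^+ 2 * hnorm (shiftS x).
Proof.
have := @resolvent_commutator (- k) Qm x; rewrite sqrrN.
by apply => //; rewrite normrN gtr0_norm.
Qed.

Lemma yosida_domS x : odom S x -> odom S (yosida x).
Proof.
move=> hx; apply: (sym_domZ symS); apply: (sym_domD symS).
  by have [] := comm_p hx.
by have [] := comm_m hx.
Qed.

Lemma cut_domS x : odom S x -> odom S (cut x).
Proof.
move=> hx; apply: (sym_domZ symS); apply: (sym_domB symS).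
  by have [] := comm_m hx.
by have [] := comm_p hx.
Qed.

Lemma yosida_comm x : odom S x ->
  hnorm (S (yosida x) - yosida (S x)) <= 2 * c * hnorm (shiftS x).
Proof.
move=> hx; have [d1 h1] := comm_p hx; have [d2 h2] := comm_m hx.
rewrite (symZ symS) ?(symD symS) //; last exact: (sym_domD symS).
rewrite -scalerBr opprD addrACA hnormMr ger0_norm; last by rewrite divr_ge0 // sqr_ge0.
have -> : 2 * c * hnorm (shiftS x) = k ^+ 2 / 2 * (2 * c / k ^+ 2 * hnorm (shiftS x)
    + 2 * c / k ^+ 2 * hnorm (shiftS x)) by field.
rewrite ler_pM2l ?divr_gt0 ?exprn_gt0 //.
by apply: le_trans (hnorm_add hF _ _) (lerD h1 h2).
Qed.

Lemma cut_comm x : odom S x ->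
  hnorm (S (cut x) - cut (S x)) <= 2 * c / k * hnorm (shiftS x).
Proof.
move=> hx; have [d1 h1] := comm_p hx; have [d2 h2] := comm_m hx.
rewrite (symZ symS) ?(symB symS) //; last exact: (sym_domB symS).
rewrite -scalerBr opprD addrACA -opprD hnorm_im gtr0_norm ?divr_gt0 //.
have -> : 2 * c / k * hnorm (shiftS x) = k / 2 * (2 * c / k ^+ 2 * hnorm (shiftS x)
    + 2 * c / k ^+ 2 * hnorm (shiftS x)) by field.
rewrite ler_pM2l ?divr_gt0 //.
by apply: le_trans (hnorm_sub hF _ _) (lerD h2 h1).
Qed.

Definition approx : oper F F := Oper (odom S) (fun x => S (J x) + yosida x).

Lemma approx_sym : symmetric_oper approx.
Proof.
split => /=; [exact: sym_domD symS|exact: sym_domZ symS| | |].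
- by move=> x y hx hy; rewrite yosidaD addrACA -(symD twist_sym).
- by move=> l x hx; rewrite yosidaZ scalerDr -(symZ twist_sym).
- by move=> x y hx hy; rewrite ipDl ipDr ip_yosida -(sym_ip twist_sym hx hy).
Qed.

(** [yosida] is bounded by k, so the perturbation argument applies at the rescaled parameter of
    modulus k + 1; [onto_pos] returns to mu. *)
Lemma approx_onto mu : mu != 0 -> onto approx mu.
Proof.
move=> mu0; have m0 : 0 < `|mu| by rewrite normr_gt0.
pose t := (k + 1) / `|mu|.
have t0 : 0 < t by rewrite divr_gt0 // addr_gt0.
have tmu0 : t * mu != 0 by rewrite mulf_neq0 // gt_eqF.
have : onto approx (t * mu).
  apply: (onto_perturb hF twist_sym yosidaD (ltW k0) hnorm_yosida) (twist_onto tmu0).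
  by rewrite normrM gtr0_norm // mulfVK ?normr_eq0 // ltrDl.
have ti0 : 0 < t^-1 by rewrite invr_gt0.
by move=> /(onto_pos hF approx_sym tmu0 ti0); rewrite mulKf // gt_eqF.
Qed.

Let K := 2 + 2 * c.
Let K0 : 0 <= K. Proof. by rewrite addr_ge0 // mulr_ge0. Qed.

(** As J anticommutes with [yosida], the cross terms collapse to <x, J z> with z = [S, [yosida]] x.
    For s = |S x| and W = |w| this yields s^2 <= W^2 + 2 c W (s + W), which forces s <= (2 + 2 c) W:
    this is the origin of K. *)
Lemma approx_bound mu x : `|mu| = 1 -> odom S x ->
  hnorm (S x) <= K * hnorm (approx x - im mu *: x) /\
  hnorm (yosida x) <= K * hnorm (approx x - im mu *: x).
Proof.
move=> mu1 hx; set w := approx x - _.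
have hb := yosida_domS hx.
pose z := S (yosida x) - yosida (S x).
have e : ip w w - ip x (J z) = ip (S x) (S x) +
    (ip (yosida x) (yosida x) + (mu ^+ 2)%:C *: ip x x) :> A.
  rewrite /w (ip_shift approx_sym mu hx) /= ipDl !ipDr SJ // ip_J JK.
  have -> : ip (J (S x)) (yosida x) = ip x (J (S (yosida x))) :> A.
    by rewrite ip_J (sym_ip symS) ?SJ //; exact: domSJ.
  have -> : ip (yosida x) (J (S x)) = - ip x (J (yosida (S x))) :> A.
    by rewrite ip_yosida -[yosida (J _)]opprK -J_yosida ipNr.
  rewrite /z JB ipBr; set a := ip (S x) _; set b := ip (yosida x) _.
  set p := ip x (J (S _)); set q := ip x (J (yosida _)); set m := _ *: _.
  rewrite opprB addrAC [a + p + _]addrACA [a - q + _ + _]addrACA subrK.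
  by rewrite [p + b]addrC addrK addrA.
have xw : hnorm x <= hnorm w.
  by have := hnorm_shift_geZ hF approx_sym mu hx; rewrite mu1 mul1r.
have nz : hnorm z <= 2 * c * (hnorm (S x) + hnorm x).
  apply: le_trans (yosida_comm hx) _; rewrite ler_wpM2l ?mulr_ge0 //.
  by apply: le_trans (hnorm_sub hF _ _) _; rewrite hnorm_im normr1 mul1r.
have pos2 : cpos ((mu ^+ 2)%:C *: ip x x : A).
  by apply: cposZ (sqr_ge0 mu) _; exact: hilbert_pos.
have g : rnorm (ip w w - ip x (J z) : A) <= hnorm w ^+ 2 + hnorm x * hnorm z.
  apply: le_trans (rnormB _ _) _; rewrite hnorm_sqr lerD2l.
  by rewrite -(hnorm_J z) cauchy_schwarz.
have s2 : hnorm (S x) ^+ 2 <= hnorm w ^+ 2 + hnorm x * hnorm z.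
  apply: le_trans g; rewrite e hnorm_sqr; apply: rnorm_cpos_le.
    exact: hilbert_pos.
  by apply: cposD => //; exact: hilbert_pos.
have t2 : hnorm (yosida x) ^+ 2 <= hnorm w ^+ 2 + hnorm x * hnorm z.
  apply: le_trans g; rewrite e hnorm_sqr addrCA; apply: rnorm_cpos_le.
    exact: hilbert_pos.
  by apply: cposD => //; exact: hilbert_pos.
have := hnorm_ge0 x; have := hnorm_ge0 z; have := hnorm_ge0 (S x).
have := hnorm_ge0 (yosida x).
move: xw nz s2 t2; set a := hnorm x; set s := hnorm (S x); set W := hnorm w.
set t := hnorm (yosida x); set n := hnorm z => aW nz s2 t2 t0 s0 n0 a0.
have W0 : 0 <= W by apply: le_trans aW.
have an : a * n <= W * (2 * c * (s + W)).
  apply: ler_pM => //; apply: le_trans nz _; rewrite ler_wpM2l ?mulr_ge0 //; lra.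
have sK : s <= K * W.
  rewrite leNgt; apply/negP => h.
  have h1 : 0 <= W * (s - K * W) by rewrite mulr_ge0 // subr_ge0 ltW.
  have h2 : 0 <= c * (W * W) by rewrite !mulr_ge0.
  have h3 : 0 <= W * W by rewrite mulr_ge0.
  have s1 : 0 < s by apply: le_lt_trans h; rewrite mulr_ge0.
  have h4 : 0 < s * (s - K * W) by rewrite mulr_gt0 // subr_gt0.
  by rewrite /K in h1 h4; nra.
split => //; rewrite -ler_sqr ?nnegrE ?mulr_ge0 //.
apply: le_trans t2 _; apply: le_trans (_ : W ^+ 2 + W * (2 * c * (K * W + W)) <= _).
  rewrite lerD2l; apply: le_trans an _; rewrite ler_wpM2l // ler_wpM2l ?mulr_ge0 //; lra.
have h3 : 0 <= W * W by rewrite mulr_ge0.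
have h2 : 0 <= c * (W * W) by rewrite !mulr_ge0.
by rewrite /K; nra.
Qed.

(* The approximate solution is the cutoff [cut x] of the exact solution x of
   the regularised equation; the error is controlled because x - cut x solves
   that equation with a right-hand side of order 1/k. *)
Lemma cutoff_solution mu y : `|mu| = 1 -> odom T y -> exists z, odom sum_oper z /\
  hnorm (sum_oper z - im mu *: z - y) <=
    k^-1 * ((1 + K) * (hnorm (T y) + 2 * c * ((K + 1) * hnorm y))).
Proof.
move=> mu1 hy; have mu0 : mu != 0 by rewrite -normr_gt0 mu1.
have [x [hx ex]] := approx_onto mu0 y.
have dz : odom S (cut x) := cut_domS hx.
exists (cut x); split; first by split => //; exact: cut_dom.
have dx : odom S (x - cut x) by exact: (sym_domB symS).
pose w := approx (x - cut x) - im mu *: (x - cut x).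
(* The error contains [yosida (x - cut x)]. [hnorm_yosida] would cost a factor k and cancel the gain
   1 / k in w; [approx_bound] costs only K. *)
have [_ hw] := approx_bound mu1 dx; rewrite -/w in hw.
have [hSx _] := approx_bound mu1 hx; rewrite ex in hSx.
have hxy : hnorm x <= hnorm y.
  by have := hnorm_shift_geZ hF approx_sym mu hx; rewrite mu1 mul1r ex.
have ew : w = y - (approx (cut x) - im mu *: cut x).
  by rewrite -ex /w (symB approx_sym) // scalerBr !opprD !opprK addrACA.
have e1 : sum_oper (cut x) - im mu *: cut x - y = yosida (x - cut x) - w.
  rewrite ew /= T_cut (additive_B yosidaD) opprB [RHS]addrA; congr (_ - _).
  rewrite [RHS]addrA; congr (_ - _).
  by rewrite [S _ + yosida (cut x)]addrC [RHS]addrA subrK addrC.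
have ec : cut y = J (cut (S x)) + (yosida (cut x) - im mu *: cut x).
  by rewrite -ex /= (additive_B cutD) cutD cutZ SJ // J_cut yosida_cut -addrA.
(* Apply [cut] to the equation solved by x: it commutes with J and [yosida], so only its commutator
   with S survives. Both terms are of order 1 / k. *)
have e2 : w = (y - cut y) - J (S (cut x) - cut (S x)).
  rewrite ew ec JB /= SJ // -[_ + yosida _ - _]addrA -[RHS]addrA -opprD; congr (_ - _).
  by rewrite [RHS]addrC [RHS]addrA subrK.
rewrite e1.
have nw : hnorm w <= k^-1 * (hnorm (T y) + 2 * c * ((K + 1) * hnorm y)).
  rewrite e2 mulrDr; apply: le_trans (hnorm_sub hF _ _) _.
  apply: lerD; first exact: cut_close.
  rewrite hnorm_J; apply: le_trans (cut_comm hx) _.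
  rewrite mulrAC [leRHS]mulrC ler_wpM2r ?invr_ge0 ?(ltW k0) // ler_wpM2l ?mulr_ge0 //.
  apply: le_trans (hnorm_sub hF _ _) _; rewrite hnorm_im normr1 mul1r mulrDl mul1r.
  exact: lerD.
apply: le_trans (hnorm_sub hF _ _) _.
rewrite mulrCA mulrDl mul1r addrC; apply: lerD => //.
by apply: le_trans hw _; rewrite ler_wpM2l // /K; lra.
Qed.

Lemma cut_approx_id x y : odom T y ->
  hnorm (cut x - x) <= 2 * hnorm (x - y) + k^-1 * hnorm (T y).
Proof.
move=> hy.
have h1 := cut_close hy; have h2 := hnorm_cut (x - y).
have -> : cut x - x = cut (x - y) - (x - y) - (y - cut y).
  by rewrite (additive_B cutD) -[RHS]addrA -opprD [x - y + _]addrA subrK opprB addrA subrK.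
have h3 := hnorm_sub hF (cut (x - y) - (x - y)) (y - cut y).
have h4 := hnorm_sub hF (cut (x - y)) (x - y); lra.
Qed.

End Cutoff.

(** * Letting k tend to infinity *)

Lemma exists_cutoff (B e : R) : 0 <= B -> 0 < e -> exists k Qp Qm,
  [/\ 0 < k, 2 * c <= k, resolvent_of T k Qp, resolvent_of T (- k) Qm &
      k^-1 * B < e].
Proof.
move=> B0 e0; pose k := 2 * c + 1 + B / e.
have Be : 0 <= B / e by rewrite divr_ge0 // ltW.
have c2 : 0 <= 2 * c by rewrite mulr_ge0.
have k0 : 0 < k by rewrite /k; lra.
have kn0 : k != 0 by rewrite gt_eqF.
have nkn0 : - k != 0 by rewrite oppr_eq0.
have [Qp hp] := onto_resolvent (ontoT kn0); have [Qm hm] := onto_resolvent (ontoT nkn0).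
exists k, Qp, Qm; split=> //; first by rewrite /k; lra.
rewrite mulrC ltr_pdivrMr //.
have -> : e * k = e * (2 * c) + e + B by rewrite /k; field; rewrite gt_eqF.
have := mulr_ge0 (ltW e0) c2; lra.
Qed.

Lemma cut_strong x e : 0 < e -> exists k Qp Qm,
  [/\ 0 < k, 2 * c <= k, resolvent_of T k Qp, resolvent_of T (- k) Qm &
      hnorm (cut k Qp Qm x - x) < e].
Proof.
move=> e0; have e4 : 0 < e / 4 by rewrite divr_gt0.
have [y dy hy] := denseT x e4.
have [k [Qp [Qm [k0 hk hp hm hB]]]] := exists_cutoff (hnorm_ge0 (T y)) e4.
exists k, Qp, Qm; split=> //.
have := cut_approx_id k0 hp hm x dy; lra.
Qed.

Lemma sum_sym : symmetric_oper sum_oper.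
Proof.
split => /=.
- by move=> x y [hx1 hx2] [hy1 hy2]; split; [exact: (sym_domD symS)|exact: (sym_domD symT)].
- by move=> l x [hx1 hx2]; split; [exact: (sym_domZ symS)|exact: (sym_domZ symT)].
- by move=> x y [hx1 hx2] [hy1 hy2]; rewrite addrACA -(symD twist_sym) // -(symD symT).
- by move=> l x [hx1 hx2]; rewrite scalerDr -(symZ twist_sym) // -(symZ symT).
- move=> x y [hx1 hx2] [hy1 hy2].
  by rewrite ipDl ipDr -(sym_ip twist_sym hx1 hy1) -(sym_ip symT hx2 hy2).
Qed.

(** On dom T, [yosida x] = [cut (T x)] tends to T x, so the bound of [approx_bound], uniform in k,
    survives in the limit. *)
Lemma sum_bound mu x : `|mu| = 1 -> odom sum_oper x ->
  hnorm (S x) <= (2 + 2 * c) * hnorm (sum_oper x - im mu *: x).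
Proof.
move=> mu1 [hx1 hx2]; apply/ler_addgt0Pr => e e0.
set K := 2 + 2 * c; have K0 : 0 < K by rewrite ltr_wpDr // mulr_ge0.
have [k [Qp [Qm [k0 hk hp hm h]]]] := cut_strong (T x) (divr_gt0 e0 K0).
have [hS _] := approx_bound k0 hk hp hm mu1 hx1.
apply: le_trans hS _; rewrite -/K.
have -> : approx k Qp Qm x - im mu *: x =
    sum_oper x - im mu *: x + (cut k Qp Qm (T x) - T x).
  rewrite (cut_T k0 hp hm hx2) /= addrAC [S _ + T _ - _]addrAC.
  by rewrite -[RHS]addrA [T x + _]addrC subrK.
rewrite ltr_pdivlMr // in h.
have := hnorm_add hF (sum_oper x - im mu *: x) (cut k Qp Qm (T x) - T x); nra.
Qed.

Lemma sum_range mu y e : `|mu| = 1 -> 0 < e ->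
  exists x, odom sum_oper x /\ hnorm (sum_oper x - im mu *: x - y) < e.
Proof.
move=> mu1 e0; have e2 : 0 < e / 2 by rewrite divr_gt0.
have [y' dy hy] := denseT y e2.
pose B := (1 + (2 + 2 * c)) * (hnorm (T y') + 2 * c * (((2 + 2 * c) + 1) * hnorm y')).
have c2 : 0 <= 2 * c by rewrite mulr_ge0.
have B0 : 0 <= B.
  by do ?[apply: mulr_ge0 | apply: addr_ge0] => //; exact: hnorm_ge0.
have [k [Qp [Qm [k0 hk hp hm hB]]]] := exists_cutoff B0 e2.
have [z [dz hz]] := cutoff_solution k0 hk hp hm mu1 dy.
exists z; split=> //.
have := hnorm_sub hF (sum_oper z - im mu *: z - y') (y - y').
rewrite opprB addrA subrK; rewrite -/B in hz; lra.
Qed.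

(** [sum_bound] makes S (u n) Cauchy; then T (u n) converges by subtraction, and S and T are
    closed. *)
Lemma sum_closed : closed_oper sum_oper.
Proof.
have one0 : (1 : R) != 0 := oner_neq0 R.
have clS := sym_onto_closed_oper hF symS one0 (ontoS one0).
have clT := sym_onto_closed_oper hF symT one0 (ontoT one0).
move=> u a b du ua ub.
pose w n := sum_oper (u n) - im 1 *: u n.
have im_add : {morph (fun x => - (im 1 *: x)) : x y / x + y}.
  by move=> x z; rewrite scalerDr opprD.
have wb : hcvg w (b - im 1 *: a).
  apply: (hcvgD hF) ub (hcvg_additive im_add (C := `|1|) _ ua) => x.
  by rewrite hnormN hnorm_im.
have [m n|s us] := hcvg_cauchy hF (f := fun n => S (u n)) (C := 2 + 2 * c) _ wb.
  have dB : odom sum_oper (u m - u n) by exact: (sym_domB sum_sym).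
  have [d1 _] := du m; have [d2 _] := du n.
  rewrite -(symB symS) //; apply: le_trans (sum_bound (mu := 1) _ dB) _.
    exact: normr1.
  by rewrite (symB sum_sym) // scalerBr /w !opprD !opprK addrACA.
have NJ_add : {morph (fun x => - J x) : x y / x + y} by move=> x z; rewrite JD opprD.
have uT : hcvg (fun n => T (u n)) (b - J s).
  have -> : (fun n => T (u n)) = (fun n => sum_oper (u n) + - J (S (u n))).
    apply/funext => n; have [d _] := du n.
    by rewrite /= SJ // addrAC subrr add0r.
  apply: (hcvgD hF) ub (hcvg_additive NJ_add (C := 1) _ us) => x.
  by rewrite hnormN hnorm_J mul1r.
have [dS Sa] := clS u a s (fun n => (du n).1) ua us.
have [dT Ta] := clT u a _ (fun n => (du n).2) ua uT.
by split=> //=; rewrite SJ // Sa Ta addrC subrK.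
Qed.

Lemma sum_onto mu : `|mu| = 1 -> onto sum_oper mu.
Proof.
move=> mu1; apply: (dense_range_onto hF sum_sym _ sum_closed).
  by rewrite -normr_gt0 mu1.
by move=> y e e0; exact: sum_range.
Qed.

End AnticommutingSum.

(** * Selfadjointness and regularity *)

Section SelfadjointRegular.
Variables (R : realType) (A : cstarAlgType R) (F : formModType A).
Hypothesis hF : hilbert F.
Implicit Types (S D : oper F F) (x y z : F).

Lemma oadjoint_ip S x y : odom (oadjoint S) y -> odom S x ->
  ip (S x) y = ip x (oadjoint S y) :> A.
Proof. by move=> hy hx; exact: (xgetPex 0 hy). Qed.

Lemma selfadjoint_symmetric S : selfadjoint S -> symmetric_oper S.
Proof.
move=> [[[_ dD dZ _] _ [SD SZ _] _] [domE valE]]; split=> // x y hx hy.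
by rewrite (valE y hy) oadjoint_ip // -domE.
Qed.

Lemma oclosed_closed S : oclosed S -> closed_oper S.
Proof.
move=> clS u a b du ua ub.
suff /clS[x dx [<- <-]] : hclosure (graph S) (a, b) by [].
move=> e e0; have e2 : 0 < e / 2 by rewrite divr_gt0.
have [N hN] := ua _ e2; have [M hM] := ub _ e2; pose n := maxn N M.
exists (u n, S (u n)); first by exists (u n).
apply: le_lt_trans (hnorm_pair_le _) _ => /=.
have := hN n (leq_maxl _ _); have := hM n (leq_maxr _ _).
by rewrite hnormBC (hnormBC (u n)); lra.
Qed.

(** For nu = 1 and nu = -1, (S - i nu) (S + i nu) = 1 + S* S, so regularity gives S - i nu dense
    range. Positive rescaling keeps the sign of the parameter, hence the two cases. *)
Lemma selfadjoint_regular_onto S mu : selfadjoint S -> regular S -> mu != 0 ->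
  onto S mu.
Proof.
move=> saS [_ clS dr]; have symS := selfadjoint_symmetric saS.
have [_ [domE valE]] := saS.
have onto_unit nu : nu ^+ 2 = 1 -> onto S nu.
  move=> nu1; have nu0 : nu != 0 by rewrite -sqrf_eq0 nu1 oner_neq0.
  apply: (dense_range_onto hF symS nu0 (oclosed_closed clS)) => y e e0.
  have [_ [x [_ [dx adjSx]] <-] hx] := dr y e e0.
  have dSx : odom S (S x) by rewrite domE.
  have dx' : odom S (im nu *: x) by exact: (sym_domZ symS).
  exists (S x + im nu *: x); split; first exact: (sym_domD symS).
  rewrite (symD symS) // (symZ symS) // scalerDr opprD addrA addrK.
  rewrite scalerA imM -expr2 nu1 scaleN1r opprK hnormBC addrC.
  by rewrite (valE _ dSx).
move=> mu0; have [mu_gt|mu_le] := ltP 0 mu.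
  by have := onto_pos hF symS (oner_neq0 R) mu_gt (onto_unit 1 (expr1n _ _)); rewrite mulr1.
have nmu : 0 < - mu by rewrite oppr_gt0 lt_neqAle mu0.
have n1 : (- 1 : R) != 0 by rewrite oppr_eq0 oner_neq0.
have := onto_pos hF symS n1 nmu (onto_unit (-1) _).
by rewrite mulrN1 opprK; apply; rewrite sqrrN expr1n.
Qed.

(** For d = y - z and x in X closer to d than |d|, |d|^2 = |<d - x, d>| < |d|^2 unless d = 0. *)
Lemma dense_ip_unique (X : set F) y z : hdense X ->
  (forall x, X x -> ip x y = ip x z :> A) -> y = z.
Proof.
move=> dX h; apply/eqP; rewrite -subr_eq0; apply/eqP.
set d := y - z; have [//|d0] := eqVneq (hnorm d) 0; first exact: (hnorm0_eq0 hF).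
have dgt : 0 < hnorm d by rewrite lt_neqAle eq_sym d0 hnorm_ge0.
have [x Xx hx] := dX d _ dgt.
have e : ip d d = ip (d - x) d :> A.
  by rewrite [in RHS]ipBl [ip x d]ipBr h // subrr subr0.
by have := cauchy_schwarz hF (d - x) d; rewrite -e -hnorm_sqr => h1; exfalso; nra.
Qed.

(** If D* y = z and (D - i) x = z - i y, then y - x is orthogonal to the range of D + i, which is
    everything; so y = x lies in dom D. Regularity holds because 1 + D* D = (D - i) (D + i) is
    onto. *)
Lemma onto_selfadjoint_regular D : is_submodule (odom D) ->
  is_linear_on (odom D) D -> symmetric_oper D -> hdense (odom D) ->
  onto D 1 -> onto D (-1) -> selfadjoint D /\ regular D.
Proof.
move=> subD linD symDop denseD onto1 ontoN1.
have adj_dom y : odom (oadjoint D) y -> odom D y.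
  move=> [z hz]; have [x [dx ex]] := onto1 (z - im 1 *: y).
  suff -> : y = x by [].
  apply/eqP; rewrite -subr_eq0; apply/eqP; have [w [dw ew]] := ontoN1 (y - x).
  apply: (hilbert_def hF); rewrite -{1}ew imN scaleNr opprK.
  rewrite ipDl ipZl conjc_im !ipBr hz // (sym_ip symDop dw dx).
  have : ip w (D x - im 1 *: x) = ip w (z - im 1 *: y) :> A by rewrite ex.
  rewrite !ipBr !ipZr scalerBr !scaleNr; set a := ip w (D x); set b := ip w z.
  set p := im 1 *: ip w x; set q := im 1 *: ip w y => h.
  by rewrite opprK addrACA -h [- a + p]addrC -opprB addNr.
have adj_eq : oper_eq D (oadjoint D).
  have dom_adj y : odom D y -> odom (oadjoint D) y.
    by move=> dy; exists (D y) => x dx; exact: (sym_ip symDop).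
  split=> [|x dx]; first by apply/seteqP; split=> y; [exact: dom_adj|exact: adj_dom].
  apply: (dense_ip_unique denseD) => y dy.
  by rewrite -oadjoint_ip ?(sym_ip symDop) //; exact: dom_adj.
have semi : semiregular D by split=> //; rewrite -adj_eq.1.
have [Q hQ] := onto_resolvent onto1.
split=> //; split=> //.
- move=> [a b] hab; suff [da Da] : odom D a /\ D a = b by exists a => //; rewrite Da.
  apply: (sym_onto_closed hF symDop (oner_neq0 R) hQ) => e e0.
  have [_ [x dx <-] hx] := hab _ e0; exists x; rewrite hnormBC (hnormBC _ b).
  split=> //; first exact: le_lt_trans (hnorm_fst_le hF hF ((a, b) - (x, D x))) hx.
  exact: le_lt_trans (hnorm_snd_le hF hF ((a, b) - (x, D x))) hx.
- move=> y e e0; exists y; last by rewrite subrr hnorm0.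
  have [u [du eu]] := onto1 y; have [x [dx ex]] := ontoN1 u.
  have Dx : D x = u - im 1 *: x by rewrite -ex imN scaleNr opprK addrK.
  have dix : odom D (im 1 *: x) by exact: (sym_domZ symDop).
  have dDx : odom D (D x) by rewrite Dx; exact: (sym_domB symDop).
  have dadj : odom (oadjoint D) (D x) by rewrite -adj_eq.1.
  exists x; first by split.
  have e1 : oadjoint D (D x) = D (D x) by exact: esym (adj_eq.2 _ dDx).
  change (x + oadjoint D (D x) = y); rewrite e1 {1}Dx (symB symDop) // (symZ symDop) // Dx.
  rewrite scalerBr scalerA imM mulr1 scaleNr -[1%:C]/(1 : R[i]) scale1r opprK.
  by rewrite opprD [D u + _]addrA [x + _]addrC subrK.
Qed.

End SelfadjointRegular.

(** * The operator matrix on E (+) E *)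

Section Doubling.
Variables (R : realType) (A : cstarAlgType R) (E : formModType A).
Hypothesis hE : hilbert E.
Implicit Types (S T : oper E E) (x y : (E * E)%type) (f : E -> E).

Definition diag_oper S : oper (E * E)%type (E * E)%type :=
  Oper [set x | odom S x.1 /\ odom S x.2] (fun x => (S x.1, S x.2)).

(* T tensored with the Pauli matrix [[0, - i], [i, 0]]. *)
Definition pauli_oper T : oper (E * E)%type (E * E)%type :=
  Oper [set x | odom T x.1 /\ odom T x.2]
       (fun x => (- ('i%C *: T x.2), 'i%C *: T x.1)).

Definition swap x := (x.2, x.1).

Lemma diag_sym S : symmetric_oper S -> symmetric_oper (diag_oper S).
Proof.
move=> symS; split => /=.
- by move=> x y [hx1 hx2] [hy1 hy2]; split; exact: (sym_domD symS).
- by move=> l x [hx1 hx2]; split; exact: (sym_domZ symS).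
- by move=> x y [hx1 hx2] [hy1 hy2]; rewrite !(symD symS).
- by move=> l x [hx1 hx2]; rewrite !(symZ symS).
- by move=> x y [hx1 hx2] [hy1 hy2]; rewrite !ip_pair /= !(sym_ip symS).
Qed.

Lemma diag_onto S mu : onto S mu -> onto (diag_oper S) mu.
Proof.
move=> hS [u v]; have [a [da ea]] := hS u; have [b [db eb]] := hS v.
by exists (a, b); split=> //; rewrite -ea -eb.
Qed.

Lemma pauli_sym T : symmetric_oper T -> symmetric_oper (pauli_oper T).
Proof.
move=> symT; split => /=.
- by move=> x y [hx1 hx2] [hy1 hy2]; split; exact: (sym_domD symT).
- by move=> l x [hx1 hx2]; split; exact: (sym_domZ symT).
- move=> x y [hx1 hx2] [hy1 hy2]; rewrite !(symD symT) // !scalerDr.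
  by congr pair; rewrite opprD.
- move=> l x [hx1 hx2]; rewrite !(symZ symT) //.
  by congr pair; rewrite ?scalerN !scalerA mulrC.
- move=> x y [hx1 hx2] [hy1 hy2]; rewrite !ip_pair /= !(ipNl, ipNr, ipZl, ipZr).
  rewrite !(sym_ip symT) // (_ : conjc 'i%C = - 'i%C); last by simpc.
  by rewrite !scaleNr opprK addrC.
Qed.

(* (a + b, i (a - b)) is the decomposition along the eigenspaces 1 and -1 of the
   Pauli matrix. *)
Lemma pauli_onto T mu : symmetric_oper T -> onto T mu -> onto T (- mu) ->
  onto (pauli_oper T) mu.
Proof.
move=> symT hT hT' [u v].
have ii (x : E) : 'i%C *: ('i%C *: x) = - x.
  by rewrite scalerA -expr2 sqr_i scaleN1r.
have [a [da ea]] := hT ((2^-1)%:C *: (u - 'i%C *: v)).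
(* On the eigenspace -1 the operator acts as - T, and - T - i mu = - (T + i mu): hence the sign and
   the parameter - mu. *)
have [b [db eb]] := hT' (- ((2^-1)%:C *: (u + 'i%C *: v))).
have half (x : E) : (2^-1)%:C *: (x + x) = x.
  rewrite scalerDr -scalerDl -rmorphD /=.
  have -> : 2^-1 + 2^-1 = 1 :> R by lra.
  exact: scale1r.
rewrite imN scaleNr opprK in eb.
exists (a + b, 'i%C *: (a - b)); split=> /=.
  split; first exact: (sym_domD symT).
  by apply: (sym_domZ symT); exact: (sym_domB symT).
have dB : odom T (a - b) by exact: (sym_domB symT).
have e1 : (T a - im mu *: a) - (T b + im mu *: b) = u.
  by rewrite ea eb opprK -scalerDr addrACA addNr addr0 half.
have e2 : 'i%C *: ((T a - im mu *: a) + (T b + im mu *: b)) = v.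
  rewrite ea eb -scalerBr opprD addrACA subrr add0r -opprD scalerN scalerN.
  by rewrite scalerA mulrC -scalerA scalerDr ii -opprD scalerN opprK half.
congr pair => /=.
- rewrite (symZ symT) // ii opprK (symB symT) // -[RHS]e1 scalerDr !opprD.
  by rewrite addrACA.
- rewrite (symD symT) // -[RHS]e2 [im mu *: ('i%C *: _)]scalerA [im mu * _]mulrC
    -scalerA -scalerBr.
  by congr (_ *: _); rewrite scalerBr opprB [_ - im mu *: a]addrC addrACA.
Qed.

Lemma hdense_pair (X Z : set E) : hdense X -> hdense Z ->
  hdense [set x : (E * E)%type | X x.1 /\ Z x.2].
Proof.
move=> dX dZ x e e0; have e2 : 0 < e / 2 by rewrite divr_gt0.
have [a Xa ha] := dX x.1 _ e2; have [b Zb hb] := dZ x.2 _ e2.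
exists (a, b) => //; apply: le_lt_trans (hnorm_pair_le _) _ => /=; lra.
Qed.

End Doubling.

(** * From the core to the whole domain of T *)

Section CommutatorExtension.
Variables (R : realType) (A : cstarAlgType R) (E : formModType A).
Hypothesis hE : hilbert E.
Variables (S T : oper E E) (symS : symmetric_oper S) (symT : symmetric_oper T).
Hypothesis ontoT : onto T 1.
Variables (Q : E -> E) (hQ : resolvent_of S 1 Q).

Let one0 : (1 : R) != 0. Proof. exact: oner_neq0. Qed.
Let QD := resD hE symS one0 hQ.

Lemma resolvent_res xi : resolvent S 1 xi = Q xi.
Proof.
have [dQ eQ] := hQ xi.
have e (x : E) : S x + -1 *: (('i * 1%:C) *: x) = S x - im 1 *: x.
  by rewrite scaleN1r.
apply/esym.
have [|[dr _] er] := @xgetPex _ 0 [set x |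
    odom (osub S (oscale ('i * 1%:C) oid)) x /\
    osub S (oscale ('i * 1%:C) oid) x = xi].
  by exists (Q xi); split=> //; rewrite /= e.
by apply: (res_unique hE symS one0 hQ) => //; rewrite -e.
Qed.

(** T S Q xi = T xi + i T Q xi, so (S - i) T Q xi = T xi + Y xi; apply Q. The resulting identity no
    longer needs T Q xi in dom S, which lets it pass to limits. *)
Lemma commutator_res (X : set E) (Y : E -> E) xi : X `<=` odom T -> X xi ->
  odom S (Q xi) -> odom T (Q xi) -> odom S (T (Q xi)) ->
  Y xi = ocomp (commutator S T) (resolvent S 1) xi ->
  T (Q xi) = Q (T xi) + Q (Y xi).
Proof.
move=> XT Xxi dS dT dST eY.
have {}eY : Y xi = S (T (Q xi)) - T (S (Q xi)).
  by rewrite -resolvent_res -scaleN1r.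
have dTxi := XT _ Xxi; rewrite -QD; apply/esym/(res_unique hE symS one0 hQ) => //.
have e : T (S (Q xi)) = T xi + im 1 *: T (Q xi).
  by rewrite (resE hQ) (symD symT) ?(symZ symT) //; exact: (sym_domZ symT).
by rewrite eY e opprD addrCA [T xi + (_ - _)]addrA subrr add0r.
Qed.

(** For y in the core tending to x in graph norm, Q y and T Q y = Q (T y + Y y) converge because Q
    and Y are bounded; T is closed. *)
Lemma resolvent_core (X : set E) (Y : E -> E) (c : R) : {morph Y : x y / x + y} ->
  (forall x, hnorm (Y x) <= c * hnorm x) -> is_core T X ->
  (forall xi, X xi -> odom T (Q xi) /\ T (Q xi) = Q (T xi) + Q (Y xi)) ->
  forall x, odom T x -> odom T (Q x) /\ T (Q x) = Q (T x) + Q (Y x).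
Proof.
move=> YD Yc [XT core] h x dx.
have [P hP] := onto_resolvent ontoT.
apply: (sym_onto_closed hE symT one0 hP) => e e0.
have c1 : 0 < 1 + `|c| + 1 by rewrite addr_gt0 // ltr_wpDr.
have [y Xy hy] := core x dx _ (divr_gt0 e0 c1).
have h1 := le_lt_trans (hnorm_fst_le hE hE _) hy.
have h2 := le_lt_trans (hnorm_snd_le hE hE _) hy.
rewrite /= in h1 h2; set d := e / _ in h1 h2.
have dE : d * (1 + `|c| + 1) = e by rewrite mulfVK ?gt_eqF.
have d0 : 0 < d by rewrite divr_gt0.
have [dQ eQ] := h y Xy; have dy := XT _ Xy.
have Qn z : hnorm (Q z) <= hnorm z.
  by have := hnorm_res hE symS hQ z; rewrite normr1 mul1r.
have cn := ler_norm c; have c0 := normr_ge0 c.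
exists (Q y); split=> //.
- rewrite hnormBC -(additive_B QD); apply: le_lt_trans (Qn _) _.
  have := mulr_ge0 c0 (ltW d0); lra.
- rewrite eQ -!QD hnormBC -(additive_B QD); apply: le_lt_trans (Qn _) _.
  rewrite opprD addrACA -(symB symT) // -(additive_B YD).
  have h3 := Yc (x - y); have := hnorm_add hE (T (x - y)) (Y (x - y)).
  have := ler_wpM2l c0 (ltW h1).
  have := ler_wpM2r (hnorm_ge0 (x - y)) cn; lra.
Qed.

(** s = Q ((S - i) s) for s in dom S; approximate (S - i) s by elements of dom T, which Q maps into
    both domains. *)
Lemma domain_dense : hdense (odom S) -> hdense (odom T) ->
  (forall x, odom T x -> odom T (Q x)) -> hdense (odom S `&` odom T).
Proof.
move=> dS dT QT x e e0; have e2 : 0 < e / 2 by rewrite divr_gt0.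
have [s ds hs] := dS x _ e2; have [t dt ht] := dT (S s - im 1 *: s) _ e2.
exists (Q t); first by split; [exact: res_dom hQ _|exact: QT].
have h1 := hnorm_res hE symS hQ (S s - im 1 *: s - t).
rewrite normr1 mul1r (additive_B QD) (resK hE symS one0 hQ ds) in h1.
by have := hnorm_add hE (x - s) (s - Q t); rewrite addrA subrK; lra.
Qed.

End CommutatorExtension.

(** * Selfadjointness and regularity of D *)

Section Main.
Variables (R : realType) (A : cstarAlgType R) (E : hilbertModType A).

Lemma offdiag_selfadjoint_regular (S T : oper E E) (X : set E) (Y : E -> E) :
  selfadjoint S -> regular S -> selfadjoint T -> regular T -> is_core T X ->
  (forall xi, X xi -> let eta := resolvent S 1 xi in
     [/\ odom S eta, odom T eta & odom S (T eta)]) ->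
  is_linear_on setT Y -> bounded_oper Y ->
  (forall xi, X xi -> Y xi = ocomp (commutator S T) (resolvent S 1) xi) ->
  let D := offdiag (osub S (oscale 'i%C T)) (oadd S (oscale 'i%C T)) in
  selfadjoint D /\ regular D.
Proof.
move=> S_sa S_reg T_sa T_reg X_core X_res [YD0 YZ0 _] [M YM] Ycomm D.
have hE := hilbertMod_hilbert E; have hF := hilbert_pair hE hE.
have one0 : (1 : R) != 0 := oner_neq0 R.
have symS := selfadjoint_symmetric S_sa; have symT := selfadjoint_symmetric T_sa.
have ontoS mu : mu != 0 -> onto S mu by exact: selfadjoint_regular_onto.
have ontoT mu : mu != 0 -> onto T mu by exact: selfadjoint_regular_onto.
have [Q hQ] := onto_resolvent (ontoS 1 one0).
have YD : {morph Y : x y / x + y} by move=> x y; exact: YD0.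
have YZ (l : R[i]) x : Y (l *: x) = l *: Y x by exact: YZ0.
have [XT _] := X_core.
have QT x : odom T x -> odom T (Q x) /\ T (Q x) = Q (T x) + Q (Y x).
  apply: (resolvent_core hE symS symT (ontoT 1 one0) hQ YD YM X_core) => xi Xxi.
  have [] := X_res xi Xxi; rewrite (resolvent_res hE symS hQ) => dS dT dST.
  split=> //; apply: (commutator_res hE symS symT hQ XT Xxi) => //.
  exact: Ycomm.
have [[[S0 _ _ SMd] denseS [_ _ SM] _] _] := S_sa.
have [[[T0 _ _ TMd] denseT [_ _ TM] _] _] := T_sa.
have QD := resD hE symS one0 hQ; have QZ := resZ hE symS one0 hQ.
pose Q2 (x : (E * E)%type) := (Q x.1, Q x.2).
(* The commutator of the two doubled operators is [S, T] placed in the Pauli matrix, so Y is placed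
   there too. *)
pose Y2 (x : (E * E)%type) := (- ('i%C *: Y x.2), 'i%C *: Y x.1).
have ontoD mu : `|mu| = 1 -> onto (sum_oper (diag_oper S) (pauli_oper T) (@swap _ _ E)) mu.
  (* The constant must be nonnegative, hence |M|; the factor 2 comes from adding the two
     components. *)
  apply: (@sum_onto _ _ _ hF _ _ (diag_sym symS) (pauli_sym symT) _ _ (@swap _ _ E)
    _ _ _ _ _ _ _ _ Y2 Q2 (2 * `|M|)) => //=.
  - by move=> nu nu0; exact/diag_onto/ontoS.
  - move=> nu nu0; apply: pauli_onto => //; apply: ontoT => //.
    by rewrite oppr_eq0.
  - by case.
  - by move=> x y; rewrite !ip_pair addrC.
  - by move=> x [].
  - by move=> x [].
  - by move=> x [hx1 hx2]; rewrite -[RHS]/(- _, - _) opprK.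
  - by move=> x y; rewrite /Y2 /= !YD !scalerDr opprD.
  - move=> x; apply: le_trans (hnorm_pair_le _) _; rewrite /= hnormN !hnormMi.
    have h1 := hnorm_fst_le hE hE x; have h2 := hnorm_snd_le hE hE x.
    have h3 := YM x.1; have h4 := YM x.2; have h5 := ler_norm M.
    have := hnorm_ge0 x.1; have := hnorm_ge0 x.2; have := normr_ge0 M; nra.
  - move=> [u v]; split; first by split; exact: res_dom hQ _.
    by congr pair; have [] := hQ u; have [] := hQ v.
  - by move=> x [hx1 hx2]; split; [have [] := QT _ hx1|have [] := QT _ hx2].
  - move=> x [hx1 hx2]; have [_ e1] := QT _ hx1; have [_ e2] := QT _ hx2.
    rewrite e1 e2 /Q2 /=.
    by congr pair; rewrite ?(additive_N QD) !QZ scalerDr ?opprD.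
  - exact: hdense_pair.
have eD : D = sum_oper (diag_oper S) (pauli_oper T) (@swap _ _ E).
  rewrite /D /sum_oper /offdiag; congr Oper.
    by apply/seteqP; split=> x /= [[? ?] [? ?]].
  by apply/funext => x /=; congr pair; rewrite scaleN1r.
rewrite eD; apply: (onto_selfadjoint_regular hF) => //=.
- split=> //=.
  + by move=> x y [[? ?] [? ?]] [[? ?] [? ?]]; split; split;
      do [exact: (sym_domD symS)|exact: (sym_domD symT)].
  + by move=> l x [[? ?] [? ?]]; split; split;
      do [exact: (sym_domZ symS)|exact: (sym_domZ symT)].
  + by move=> x a [[? ?] [? ?]]; split; split; do [exact: SMd|exact: TMd].
- split=> /=.
  + move=> x y [[? ?] [? ?]] [[? ?] [? ?]].
    rewrite !(symD symS) ?(symD symT) // !scalerDr opprD.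
    by congr pair; rewrite addrACA.
  + move=> l x [[? ?] [? ?]]; rewrite !(symZ symS) ?(symZ symT) //.
    by congr pair; rewrite scalerDr ?scalerN !scalerA mulrC.
  + move=> x a [[? ?] [? ?]]; rewrite !SM ?TM //.
    by congr pair; rewrite ractDl ?ractNl ractZl.
- apply: (sum_sym (diag_sym symS) (pauli_sym symT)) => //=.
  + by move=> x y; rewrite !ip_pair addrC.
  + by move=> x [].
- have dST := domain_dense hE symS hQ denseS denseT (fun x dx => (QT x dx).1).
  move=> x e e0; have [y [[? ?] [? ?]] hy] := hdense_pair dST dST x e0.
  by exists y.
- by apply: ontoD; rewrite normr1.
- by apply: ontoD; rewrite normrN normr1.
Qed.

End Main.

End HilbertModules.

Local Open Scope classical_set_scope.
Local Open Scope ring_scope.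
Local Open Scope complex_scope.

Theorem theorem7p10 (R : realType) (A : cstarAlgType R) (E : hilbertModType A)
    (S T : oper E E)
    (S_sa : selfadjoint S) (S_reg : regular S)
    (T_sa : selfadjoint T) (T_reg : regular T)
    (X : set E) (X_sub : is_submodule X) (X_dense : hdense X)
    (X_core : is_core T X)
    (X_res : forall mu : R, mu != 0 -> forall xi : E, X xi ->
       let eta := resolvent S mu xi in
       [/\ odom S eta, odom T eta & odom S (T eta)])
    (X_comm : forall mu : R, mu != 0 ->
       exists Xmu : E -> E,
         [/\ is_linear_on setT Xmu, bounded_oper Xmu &
             forall xi : E, X xi ->
               Xmu xi = ocomp (commutator S T) (resolvent S mu) xi]) :
  let D := offdiag (osub S (oscale 'i T)) (oadd S (oscale 'i T)) in
  selfadjoint D /\ regular D.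
Proof.
have one0 : (1 : R) != 0 by exact: GRing.oner_neq0.
have [Y [Y_lin Y_bnd Y_comm]] := X_comm 1 one0.
exact: (HilbertModules.offdiag_selfadjoint_regular S_sa S_reg T_sa T_reg X_core
  (X_res 1 one0) Y_lin Y_bnd Y_comm).
Qed.
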